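(* Let $p,p',q,q'$ be integers with $\max(0,p-1)\le p'\le p$, $p+p'\ge1$, $\max(0,q-1)\le q'\le q$, $q+q'\ge1$. Consider the diffusion equation $w_t=\nu w_{xx}$, $\nu>0$, on a periodic interval (i.e. cell Péclet number $\mathrm{Pe}=0$). Then the semi-discretized hybrid-variable method $$\overline{w}'_{j+1/2}-\frac{\nu}{h}\left([\mathcal{D}_x^cw]_{j+1}-[\mathcal{D}_x^cw]_j\right)=0,\qquad w'_j-\nu[\mathcal{D}_{xx}^cw]_j=0,$$ constructed from the central operators $[\mathcal{D}_x^c]$ and $[\mathcal{D}_{xx}^c]$ with the optimal coefficients given in the context, is stable for all $h$; that is, for every number of cells $N$ its $2N\times2N$ coefficient matrix $\boldsymbol{K}$ is stable.
   Context: The domain $[0,L]$ with periodic boundary conditions is divided into $N$ cells of size $h=L/N$; $x_j=jh$, indices modulo $N$; $w_j$ are nodal unknowns, $\overline{w}_{j+1/2}$ cell-averaged unknowns. Constants: for integers $l,r\ge0$, $-l\le\nu\le r$: $\zeta_\nu^{l,r}=H_{l+\nu}-H_{r-\nu}$, $C_\nu^{l,r}=\frac{l!\,r!}{(l+\nu)!(r-\nu)!}$, $H_n=1+\frac12+\cdots+\frac1n$, $H_0=0$. $\delta$ is the Kronecker delta; empty sums are zero. $[\mathcal{D}_x^cw]_j=\frac1h\sum_{k=-p}^{p-1}\alpha_k^c\overline{w}_{j+k+1/2}+\frac1h\sum_{k=-p'}^{p'}\beta_k^cw_{j+k}$ with $\alpha_\nu^c=-\alpha_{-1-\nu}^c$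 for $-p\le\nu<0$; $\alpha_\nu^c=\sum_{k=\nu+1}^{p'}\frac{2(1+k(\zeta_k^{p,p}+\zeta_k^{p',p'}))}{k^2}C_k^{p,p}C_k^{p',p'}+(1-\delta_{pp'})\frac{2}{p^2}C_p^{p,p}C_p^{p',p}$ for $0\le\nu\le p-1$; $\beta_0^c=0$; $\beta_\nu^c=-\frac{2}{\nu}C_\nu^{p,p}C_\nu^{p',p'}$ for $-p'\le\nu\le p'$, $\nu\ne0$. $[\mathcal{D}_{xx}^cw]_j=\frac1{h^2}\sum_{k=-q}^{q-1}a_k\overline{w}_{j+k+1/2}+\frac1{h^2}\sum_{k=-q'}^{q'}b_kw_{j+k}$ with $a_\nu=a_{-1-\nu}$ for $-q\le\nu<0$; $a_\nu=\sum_{k=\nu+1}^{q'}\frac{6(2+k(\zeta_k^{q,q}+\zeta_k^{q',q'}))}{k^3}C_k^{q,q}C_k^{q',q'}+(1-\delta_{qq'})\frac{6}{q^3}C_q^{q,q}C_q^{q',q}$ for $0\le\nu\le q-1$; $b_0=-\sum_{-q\le k\le q,k\ne0}\frac{3}{k^2}-\sum_{-q'\le k\le q',k\ne0}\frac{3}{k^2}$; $b_\nu=-\frac{6}{\nu^2}C_\nu^{q,q}C_\nu^{q',q'}$ for $-q'\le\nu\le q'$, $\nu\ne0$. Matrix form: with $\boldsymbol{w}=[\overline{w}_{1/2},\dots,\overline{w}_{N-1/2},w_0,\dots,w_{N-1}]^T$ the system is $\boldsymbol{w}'=\frac{\nu}{h^2}\boldsymbol{K}\boldsymbol{w}$, where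 $$\boldsymbol{K}=\begin{bmatrix}(\boldsymbol{S}-\boldsymbol{I})G^c(\boldsymbol{S})&(\boldsymbol{S}-\boldsymbol{I})H^c(\boldsymbol{S})\\ A(\boldsymbol{S})&B(\boldsymbol{S})\end{bmatrix},$$ $\boldsymbol{S}$ is the $N\times N$ cyclic shift matrix ($(\boldsymbol{S}v)_j=v_{j+1}$, indices mod $N$), and $G^c(s)=\sum_{k=-p}^{p-1}\alpha_k^cs^k$, $H^c(s)=\sum_{k=-p'}^{p'}\beta_k^cs^k$, $A(s)=\sum_{k=-q}^{q-1}a_ks^k$, $B(s)=\sum_{k=-q'}^{q'}b_ks^k$. A square complex matrix is called stable if each of its eigenvalues $\lambda$ either has negative real part, or has $\mathrm{Re}\,\lambda=0$ and is simple. *)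

(* Defs.v *)
From HB Require Import structures.
From mathcomp Require Import all_boot all_order all_algebra.
From mathcomp Require Import reals complex.

Set Implicit Arguments.
Unset Strict Implicit.
Unset Printing Implicit Defensive.

Import Order.TTheory GRing.Theory Num.Theory.
Local Open Scope ring_scope.

(* Integers k with -m <= k < n, in increasing order. *)
Definition zrange (m n : nat) : seq int :=
  [seq i%:Z - m%:Z | i <- iota 0 (m + n)].

Section Coefficients.
Variable R : realType.

Definition harmonic_number (n : nat) : R := \sum_(1 <= k < n.+1) k%:R^-1.

(* zeta_k^{l,r} and C_k^{l,r}; the absolute values are only conversions from
   int to nat, as these are used for - l <= k <= r. *)
Definition zeta (l r : nat) (k : int) : R :=
  harmonic_number (absz (l%:Z + k)) - harmonic_number (absz (r%:Z - k)).

Definition Ccoef (l r : nat) (k : int) : R :=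
  l`!%:R * r`!%:R / ((absz (l%:Z + k))`!%:R * (absz (r%:Z - k))`!%:R).

Definition alpha_nonneg (p p' n : nat) : R :=
  \sum_(n.+1 <= k < p'.+1)
     2 * (1 + k%:R * (zeta p p k + zeta p' p' k)) / k%:R ^+ 2
       * Ccoef p p k * Ccoef p' p' k
  + (1 - (p == p')%:R) * (2 / p%:R ^+ 2) * Ccoef p p p * Ccoef p' p p.

(* Negz n is -(n + 1), so that -1 - Negz n = n. *)
Definition alpha (p p' : nat) (k : int) : R :=
  match k with
  | Posz n => alpha_nonneg p p' n
  | Negz n => - alpha_nonneg p p' n
  end.

Definition beta (p p' : nat) (k : int) : R :=
  if k == 0 then 0 else - (2 / k%:~R) * Ccoef p p k * Ccoef p' p' k.

Definition a_nonneg (q q' n : nat) : R :=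
  \sum_(n.+1 <= k < q'.+1)
     6 * (2 + k%:R * (zeta q q k + zeta q' q' k)) / k%:R ^+ 3
       * Ccoef q q k * Ccoef q' q' k
  + (1 - (q == q')%:R) * (6 / q%:R ^+ 3) * Ccoef q q q * Ccoef q' q q.

Definition acoef (q q' : nat) (k : int) : R :=
  match k with
  | Posz n => a_nonneg q q' n
  | Negz n => a_nonneg q q' n
  end.

Definition bcoef (q q' : nat) (k : int) : R :=
  if k == 0 then
    - (\sum_(i <- zrange q q.+1 | i != 0) 3 / i%:~R ^+ 2)
    - (\sum_(i <- zrange q' q'.+1 | i != 0) 3 / i%:~R ^+ 2)
  else - (6 / k%:~R ^+ 2) * Ccoef q q k * Ccoef q' q' k.

End Coefficients.

Section Method.
Variables (R : realType) (n : nat).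
(* The number of cells is N = n.+1. *)
Local Notation N := n.+1.

(* Value at the integer index k, modulo N, of a periodic grid function. *)
Definition at_index (u : 'cV[R]_N) (k : int) : R :=
  u (inord (absz (k %% N%:Z)%Z)) 0.

(* wb holds the cell averages, with entry j for the cell of index j + 1/2;
   w holds the nodal values. *)
Definition Dx (p p' : nat) (h : R) (wb w : 'cV[R]_N) (j : int) : R :=
  h^-1 * (\sum_(k <- zrange p p) alpha R p p' k * at_index wb (j + k))
  + h^-1 * (\sum_(k <- zrange p' p'.+1) beta R p p' k * at_index w (j + k)).

Definition Dxx (q q' : nat) (h : R) (wb w : 'cV[R]_N) (j : int) : R :=
  (h ^+ 2)^-1 * (\sum_(k <- zrange q q) acoef R q q' k * at_index wb (j + k))
  + (h ^+ 2)^-1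
    * (\sum_(k <- zrange q' q'.+1) bcoef R q q' k * at_index w (j + k)).

(* The semi-discretized equations, at an instant where the unknowns are wb, w
   and their time derivatives are dwb, dw. *)
Definition hv_method (p p' q q' : nat) (nu h : R)
    (dwb dw wb w : 'cV[R]_N) : Prop :=
  forall j : 'I_N,
    dwb j 0 - nu / h * (Dx p p' h wb w (j%:Z + 1) - Dx p p' h wb w j%:Z) = 0
    /\ dw j 0 - nu * Dxx q q' h wb w j%:Z = 0.

Definition shift_mx : 'M[R]_N := \matrix_(i, j) (j == ordS i)%:R.

(* Value at S of the Laurent polynomial with coefficients c k, -m <= k < m';
   the shift matrix is invertible, so the integer powers are the true ones. *)
Definition laurent_shift (c : int -> R) (m m' : nat) : 'M[R]_N :=
  \sum_(k <- zrange m m') c k *: (shift_mx ^ k).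

Definition hv_matrix (p p' q q' : nat) : 'M[R]_(N + N) :=
  block_mx ((shift_mx - 1) * laurent_shift (alpha R p p') p p)
           ((shift_mx - 1) * laurent_shift (beta R p p') p' p'.+1)
           (laurent_shift (acoef R q q') q q)
           (laurent_shift (bcoef R q q') q' q'.+1).

End Method.

(* A simple eigenvalue is one of algebraic multiplicity 1. *)
Definition stable_mx (R : realType) (m : nat) (M : 'M[R[i]]_m) : Prop :=
  forall z : R[i], eigenvalue M z ->
    complex.Re z < 0 \/ (complex.Re z = 0 /\ mup z (char_poly M) = 1%N).

(* Main.v *)
(* Both block rows of K are diagonalised by the discrete Fourier transform, so
   char_poly K is the product over the N-th roots of unity s = exp(i x) of
   X^2 - (g + B) X + (g B + eta gamma), where (s - 1) G = g, H = i eta,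
   (s - 1) A = i gamma and B are, up to the factor i, real trigonometric sums.
   For x in (0, pi] one has
     g B + eta gamma = B (g - x eta) + eta (gamma + x B),
   and g - x eta, gamma + x B approximate - x^2, - x^3.  Optimality of the
   coefficients means that g - x eta is a sum of residues, hence a convolution:
   with c_k = (-1)^k C_k^{p,p}, the kernel s_p = sum_k c_k cos (k x) is a
   positive multiple of (1 - cos x)^p, its centred primitive sigma_p is negative
   on (0, pi), and
     (g - x eta) (x)
       = 2 int_0^x (sigma_p (y) s_{p'} (x - y) + sigma_{p'} (y)) dy < 0.
   Moreover eta is a negative multiple of the periodic convolution of sigma_p
   and s_{p'}, which is nonnegative on [0, pi], and (gamma + x B)' is
   3 (g - x eta) for the pair q, q'.  All these integrals are evaluated through
   one explicit antiderivative, so only the mean value theorem is used. *)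
Require Import Defs.
From mathcomp Require Import all_boot all_order all_algebra.
From mathcomp Require Import reals complex.
From mathcomp Require Import boolp topology normedtype.
From mathcomp Require Import derive realfun trigo.
From mathcomp Require Import ring lra zify.
Import Order.TTheory GRing.Theory Num.Theory.
Import numFieldNormedType.Exports.
Local Open Scope ring_scope.

(** * Derivatives of trigonometric sums and the mean value theorem *)

Section RealCalculus.
Set Implicit Arguments.
Unset Strict Implicit.
Variable R : realType.
Implicit Types f g : R -> R.

Lemma is_derive_sum_seq (I : Type) (r : seq I) (f : I -> R -> R) (x : R)
    (df : I -> R) :
    (forall i, is_derive x 1 (f i) (df i)) ->
  is_derive x 1 (fun y => \sum_(i <- r) f i y) (\sum_(i <- r) df i).
Proof.
move=> dfP; elim: r => [|i r IHr].
  rewrite big_nil; under eq_fun do rewrite big_nil.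
  exact: is_derive_cst.
rewrite big_cons; under eq_fun do rewrite big_cons.
exact: is_deriveD.
Qed.

Lemma is_derive_affine (a b x : R) : is_derive x 1 (fun y => a * y + b) a.
Proof. by apply: is_derive_eq; rewrite /GRing.scale /= addr0 !mulr1. Qed.

Lemma is_derive_cos_affine (a b x : R) :
  is_derive x 1 (fun y => cos (a * y + b)) (- (a * sin (a * x + b))).
Proof.
have := @is_derive1_comp R cos (fun y => a * y + b) x _ _
  (is_derive_cos (a * x + b)) (is_derive_affine a b x).
by rewrite mulNr mulrC.
Qed.

Lemma is_derive_sin_affine (a b x : R) :
  is_derive x 1 (fun y => sin (a * y + b)) (a * cos (a * x + b)).
Proof.
have := @is_derive1_comp R sin (fun y => a * y + b) x _ _
  (is_derive_sin (a * x + b)) (is_derive_affine a b x).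
by rewrite mulrC.
Qed.

Lemma derive_MVT {f df : R -> R} {a b : R} :
    (forall x : R, is_derive x 1 f (df x)) -> a < b ->
  exists2 c, a < c < b & f b - f a = df c * (b - a).
Proof.
move=> fP ab; have [|c] := @MVT R f df a b ab (fun x _ => fP x).
  apply: continuous_subspaceT => x.
  by apply: differentiable_continuous; apply/derivable1_diffP; case: (fP x).
by rewrite in_itv /= => cab ->; exists c.
Qed.

End RealCalculus.

(** * Even trigonometric kernels, their centred primitives and their convolutions *)

Section Convolution.
Set Implicit Arguments.
Unset Strict Implicit.
Variables (R : realType) (r : seq int).
Hypothesis r_uniq : uniq r.
Hypothesis r_sym : perm_eq [seq - k | k <- r] r.
Hypothesis r0 : 0 \in r.

Lemma sum_opp (F : int -> R) : \sum_(k <- r) F (- k) = \sum_(k <- r) F k.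
Proof. by rewrite -[RHS](perm_big _ r_sym) big_map. Qed.

Lemma sum_odd (F : int -> R) :
  (forall k : int, F (- k) = - F k) -> \sum_(k <- r) F k = 0.
Proof.
move=> Fodd; have := sum_opp F; under eq_bigr do rewrite Fodd.
by rewrite sumrN => /eqP; rewrite eq_sym -addr_eq0 -mulr2n mulrn_eq0 => /eqP.
Qed.

Definition trig_kernel (c : int -> R) (x : R) : R :=
  \sum_(k <- r) c k * cos (k%:~R * x).

(* The term k = 0 vanishes, as c 0 / 0 = 0. *)
Definition trig_prim (c : int -> R) (x : R) : R :=
  \sum_(k <- r) c k / k%:~R * sin (k%:~R * x).

Lemma is_derive_trig_prim (c : int -> R) (x : R) :
  c 0 = 1 -> is_derive x 1 (trig_prim c) (trig_kernel c x - 1).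
Proof.
move=> c0.
apply: (@is_derive_eq _ _ _ _ _ _ _
  (\sum_(k <- r) c k / k%:~R * (k%:~R * cos (k%:~R * x)))).
  apply: (is_derive_sum_seq _) => k.
  have := is_derive_sin_affine k%:~R 0 x.
  rewrite addr0; under eq_fun do rewrite addr0.
  by move=> ?; apply: is_deriveZ.
rewrite /trig_kernel !(bigD1_seq 0) //= mulr0z !mul0r cos0 c0 mulr0 mulr1.
rewrite add0r addrAC subrr add0r.
by apply: eq_bigr => k k0; rewrite mulrA divfK// intr_eq0.
Qed.

Lemma trig_primN c x : trig_prim c (- x) = - trig_prim c x.
Proof. by rewrite -sumrN; apply: eq_bigr => k _; rewrite mulrN sinN mulrN. Qed.

Lemma trig_prim0 c : trig_prim c 0 = 0.
Proof. by apply: big1 => k _; rewrite mulr0 sin0 mulr0. Qed.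

Lemma sin_intpi (k : int) : sin (k%:~R * pi) = 0 :> R.
Proof.
have sin_natpi n : sin (n%:R * pi) = 0 :> R.
  elim: n => [|n IHn]; first by rewrite mul0r sin0.
  by rewrite -natr1 mulrDl mul1r sinDpi IHn oppr0.
by case: k => n; rewrite ?NegzE ?mulrNz ?mulNr ?sinN -pmulrn sin_natpi ?oppr0.
Qed.

Lemma trig_primpi c : trig_prim c pi = 0.
Proof. by apply: big1 => k _; rewrite sin_intpi mulr0. Qed.

(* The term l = k vanishes, as x / 0 = 0. *)
Definition pole_sum (c : int -> R) (k : int) : R :=
  - \sum_(l <- r) c l / (k - l)%:~R.

Section TwoKernels.
Variables c d : int -> R.
Hypothesis c_even : forall k : int, c (- k) = c k.
Hypothesis d_even : forall k : int, d (- k) = d k.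
Hypothesis c0 : c 0 = 1.
Hypothesis d0 : d 0 = 1.

(** Antiderivative in y of sin ((k - l) y + l x). In the resonant case k = l this function is
    constant in y, which gives a linear term. *)
Definition conv_term (x : R) (k l : int) (y : R) : R :=
  if k == l then y * sin (k%:~R * x)
  else - cos ((k - l)%:~R * y + l%:~R * x) / (k - l)%:~R.

(* An explicit antiderivative in y of trig_prim c y * trig_kernel d (x - y). *)
Definition conv_prim (x y : R) : R :=
  \sum_(k <- r) \sum_(l <- r) c k / k%:~R * d l * conv_term x k l y.

Lemma is_derive_conv_term (x y : R) (k l : int) :
  is_derive y 1 (conv_term x k l) (sin ((k - l)%:~R * y + l%:~R * x)).
Proof.
rewrite /conv_term; have [->|kl] := eqVneq k l.
  rewrite subrr mul0r add0r; have := is_derive_affine (sin (l%:~R * x)) 0 y.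
  by under eq_fun do rewrite addr0 mulrC.
have klN0 : (k - l)%:~R != 0 :> R by rewrite intr_eq0 subr_eq0.
have /(is_deriveZ (- (k - l)%:~R^-1)) :=
  is_derive_cos_affine (k - l)%:~R (l%:~R * x) y.
rewrite /GRing.scale /= mulrNN mulKf// => h.
by under eq_fun do rewrite mulNr mulrC -mulNr.
Qed.

(** Each product sin (k y) cos (l (x - y)) is sin ((k - l) y + l x) minus cos (k y) sin (l (x - y)),
    and summing the latter over l against the even d gives zero. *)
Lemma is_derive_conv_prim (x y : R) :
  is_derive y 1 (conv_prim x) (trig_prim c y * trig_kernel d (x - y)).
Proof.
apply: (@is_derive_eq _ _ _ _ _ _ _
  (\sum_(k <- r) \sum_(l <- r)
      c k / k%:~R * d l * sin ((k - l)%:~R * y + l%:~R * x))).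
  apply: (is_derive_sum_seq _) => k; apply: (is_derive_sum_seq _) => l.
  by apply: is_deriveZ; exact: is_derive_conv_term.
rewrite /trig_prim big_distrl /=; apply: eq_bigr => k _.
have sin_sum0 : \sum_(l <- r) d l * sin (l%:~R * (x - y)) = 0.
  by apply: sum_odd => l; rewrite d_even mulrNz mulNr sinN mulrN.
transitivity (\sum_(l <- r) c k / k%:~R *
    (sin (k%:~R * y) * (d l * cos (l%:~R * (x - y)))
     + cos (k%:~R * y) * (d l * sin (l%:~R * (x - y))))).
  apply: eq_bigr => l _.
  have -> : (k - l)%:~R * y + l%:~R * x = k%:~R * y + l%:~R * (x - y) :> R.
    by rewrite intrD mulrNz; ring.
  by rewrite sinD; ring.
by rewrite -big_distrr big_split /= -!big_distrr /= sin_sum0 mulr0 addr0 mulrA.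
Qed.

(** By [conv_prim_period], the periodic convolution of [trig_prim c] and [trig_kernel d], divided by
    2 pi. *)
Definition prod_prim (x : R) : R :=
  \sum_(k <- r) c k * d k / k%:~R * sin (k%:~R * x).

(** Over a full period the terms with k != l return to their initial value; only the resonant
    diagonal contributes. *)
Lemma conv_prim_period (x : R) :
  conv_prim x pi - conv_prim x (- pi) = 2 * pi * prod_prim x.
Proof.
rewrite /conv_prim /prod_prim -sumrB big_distrr /=.
rewrite [LHS]big_seq [RHS]big_seq; apply: eq_bigr => k kr.
rewrite -sumrB (bigD1_seq k) //= big1 ?addr0 => [|l lk].
  by rewrite /conv_term eqxx; ring.
rewrite -mulrBr /conv_term eq_sym (negPf lk).
suff -> : cos ((k - l)%:~R * pi + l%:~R * x)
        = cos ((k - l)%:~R * - pi + l%:~R * x) :> R by rewrite subrr mulr0.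
by rewrite !cosD mulrN cosN sinN sin_intpi oppr0.
Qed.

(* For c = weight p, d = weight p' and 1 <= k <= p, this is
   (alpha_{k-1} - alpha_k) / 2, with alpha_p read as 0. *)
Definition tcoef (k : int) : R :=
  (c k * pole_sum d k + d k * pole_sum c k + c k * d k / k%:~R) / k%:~R.

(** Half of g - x eta, see [symbol_g_eta]. *)
Definition remainder (x : R) : R :=
  x * prod_prim x - \sum_(k <- r) tcoef k * (1 - cos (k%:~R * x)).

Definition conv_total (x y : R) : R :=
  conv_prim x y + \sum_(k <- r) d k / k%:~R ^+ 2 * - cos (k%:~R * y).

Lemma is_derive_conv_total (x y : R) :
  is_derive y 1 (conv_total x)
    (trig_prim c y * trig_kernel d (x - y) + trig_prim d y).
Proof.
apply: is_deriveD; first exact: is_derive_conv_prim.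
rewrite /trig_prim; apply: (is_derive_sum_seq _) => k.
have h := is_derive_cos_affine k%:~R 0 y.
rewrite addr0 in h; move: h; under eq_fun do rewrite addr0.
move=> /is_deriveN h; have := @is_deriveZ _ _ _ _ (d k / k%:~R ^+ 2) _ _ _ h.
rewrite /GRing.scale /= opprK mulrA.
suff -> : d k / k%:~R ^+ 2 * k%:~R = d k / k%:~R by [].
have [->|k0] := eqVneq k 0; first by rewrite mulr0 mulr0z invr0 mulr0.
by rewrite expr2 invfM -!mulrA mulVf ?mulr1// intr_eq0.
Qed.

(** Partial fractions: 1 / (k (k - l)) = (1 / (k - l) - 1 / k) / l. At k = 0 and k = l, where a
    quotient by zero is read as 0, this needs the two correction terms; the sum of c_k / k vanishes
    by parity. *)
Lemma sum_two_poles (l : int) : l \in r -> l != 0 ->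
  \sum_(k <- r) c k / k%:~R / (k - l)%:~R
    = (pole_sum c l + l%:~R^-1 + c l / l%:~R) / l%:~R.
Proof.
move=> lr l0; have l0R : l%:~R != 0 :> R by rewrite intr_eq0.
apply: (mulIf l0R); rewrite divfK// big_distrl /=.
have c_odd : \sum_(k <- r) c k / k%:~R = 0.
  by apply: sum_odd => k; rewrite c_even mulrNz invrN mulrN.
transitivity (\sum_(k <- r) (c k / (k - l)%:~R - c k / k%:~R
   + ((k == 0)%:R * c k / l%:~R + (k == l)%:R * c k / l%:~R))).
  apply: eq_bigr => k _; have [->|k0] := eqVneq k 0.
    rewrite eq_sym (negPf l0) sub0r mulrNz mulr0z invr0 invrN.
    by rewrite mulr1n mulr0n; ring.
  have k0R : k%:~R != 0 :> R by rewrite intr_eq0.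
  have [->|kl] := eqVneq k l; first by rewrite subrr mulr0z invr0 mulr1n mulr0n; field.
  have : (k - l)%:~R != 0 :> R by rewrite intr_eq0 subr_eq0.
  by rewrite intrD mulrNz => klR; rewrite !mulr0n; field; rewrite l0R k0R klR.
rewrite big_split sumrB c_odd subr0 big_split /= -addrA; congr (_ + (_ + _)).
- rewrite /pole_sum -sumrN; apply: eq_bigr => k _.
  by rewrite -opprB mulrNz invrN mulrN.
- rewrite (bigD1_seq 0) //= mul1r c0 big1 ?addr0 ?mul1r// => k /negPf ->.
  by rewrite !mul0r.
- rewrite (bigD1_seq l) //= eqxx mul1r big1 ?addr0// => k /negPf ->.
  by rewrite !mul0r.
Qed.

(* Collects the coefficients of each cos (m x) in the double sum. *)
Lemma conv_prim_diag (x : R) :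
  conv_prim x x - conv_prim x 0 = x * prod_prim x
   + (\sum_(k <- r) c k / k%:~R ^+ 2
   + \sum_(m <- r) (tcoef m + d m / m%:~R ^+ 2) * cos (m%:~R * x)).
Proof.
transitivity (x * prod_prim x
  + (\sum_(l <- r) d l * cos (l%:~R * x)
        * (\sum_(k <- r) c k / k%:~R / (k - l)%:~R)
   + \sum_(k <- r) c k / k%:~R * pole_sum d k * cos (k%:~R * x))).
  transitivity (x * prod_prim x
    + (\sum_(k <- r) \sum_(l <- r)
         c k / k%:~R * d l * cos (l%:~R * x) / (k - l)%:~R
     - \sum_(k <- r) \sum_(l <- r)
         c k / k%:~R * d l * cos (k%:~R * x) / (k - l)%:~R)).
    rewrite /conv_prim /prod_prim -!sumrB big_distrr -big_split /=.
    rewrite [LHS]big_seq [RHS]big_seq; apply: eq_bigr => k kr.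
    rewrite -!sumrB !(bigD1_seq k kr) //= subrr add0r.
    congr (_ + _); first by rewrite /conv_term eqxx; ring.
    apply: eq_bigr => l lk; rewrite /conv_term eq_sym (negPf lk) mulr0 add0r.
    have -> : (k - l)%:~R * x + l%:~R * x = k%:~R * x :> R.
      by rewrite -mulrDl -intrD subrK.
    ring.
  congr (_ + (_ + _)).
    rewrite exchange_big; apply: eq_bigr => l _ /=.
    by rewrite big_distrr; apply: eq_bigr => k _ /=; ring.
  rewrite -sumrN; apply: eq_bigr => k _.
  rewrite /pole_sum mulrN mulNr big_distrr big_distrl; congr (- _).
  by apply: eq_bigr => l _ /=; ring.
(* The index 0 gives the constant, the sum of c_k / k^2; for m != 0 [sum_two_poles] applies. *)
congr (_ + _); rewrite -big_split (bigD1_seq 0) //=.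
rewrite [X in _ = _ + X](bigD1_seq 0) //= addrA; congr (_ + _).
  rewrite /tcoef !mulr0z invr0 expr0n invr0 !mulr0 !mul0r cos0 d0 !mulr1.
  rewrite mul1r !addr0; apply: eq_bigr => k _.
  by rewrite subr0 expr2 invfM mulrA.
rewrite [LHS]big_seq_cond [RHS]big_seq_cond; apply: eq_bigr => m /andP[mr m0].
rewrite sum_two_poles// /tcoef expr2 invfM; ring.
Qed.

Lemma conv_total_diag (x : R) :
  conv_total x x - conv_total x 0 = remainder x.
Proof.
have diagE y : conv_total y y - conv_total y 0 = y * prod_prim y
    + (\sum_(k <- r) c k / k%:~R ^+ 2 + \sum_(k <- r) d k / k%:~R ^+ 2
       + \sum_(k <- r) tcoef k * cos (k%:~R * y)).
  rewrite /conv_total opprD addrACA conv_prim_diag -!addrA.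
  congr (_ + (_ + _)); rewrite -sumrB -!big_split /=; apply: eq_bigr => k _.
  by rewrite mulr0 cos0; ring.
(* At y = 0 the identity expresses the constants through the sum of the [tcoef], so their values
   need not be known. *)
have /esym/eqP := diagE 0; rewrite subrr mul0r add0r addr_eq0 => /eqP H.
rewrite diagE H /remainder; congr (_ + _).
rewrite -!sumrN -big_split /=; apply: eq_bigr => k _.
by rewrite mulr0 cos0; ring.
Qed.

(** The diagonal identity at x = 0. It is what makes the central coefficient b_0 fit, see
    [bcoef0]. *)
Lemma sum_tcoef : \sum_(k <- r) tcoef k
  = - (\sum_(k <- r) c k / k%:~R ^+ 2 + \sum_(k <- r) d k / k%:~R ^+ 2).
Proof.
have /esym := conv_prim_diag 0.
rewrite subrr mul0r add0r; under [X in _ + X = _]eq_bigr do rewrite mulr0 cos0 mulr1.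
by rewrite big_split addrCA /= => /eqP; rewrite addr_eq0 => /eqP.
Qed.

End TwoKernels.
End Convolution.

(** * Signs of primitives, convolutions and symbols *)

Section Signs.
Set Implicit Arguments.
Unset Strict Implicit.
Variables (R : realType) (r : seq int).
Hypothesis r_uniq : uniq r.
Hypothesis r_sym : perm_eq [seq - k | k <- r] r.
Hypothesis r0 : 0 \in r.

Lemma one_sub_cos_ge0 (x : R) : 0 <= 1 - cos x.
Proof. by rewrite subr_ge0 cos_le1. Qed.

Lemma one_sub_cos_mono (x y : R) :
  0 <= x -> x < y -> y <= pi -> 1 - cos x < 1 - cos y.
Proof.
move=> x0 xy ypi; rewrite ltrD2l ltrN2 ltr_cos// in_itv /=.
  by rewrite x0 (le_trans (ltW xy)).
by rewrite (le_trans x0 (ltW xy)).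
Qed.

(** The primitive vanishes at 0 and at pi, so the mean value theorem applies on both sides of x. *)
Lemma trig_prim_mean_values (c : int -> R) (x : R) : c 0 = 1 -> 0 < x -> x < pi ->
  exists y z, [/\ 0 < y, y < z, z < pi,
     trig_prim r c x = (trig_kernel r c y - 1) * x &
     - trig_prim r c x = (trig_kernel r c z - 1) * (pi - x)].
Proof.
move=> c0 x0 xpi.
have [y /andP[y0 yx] yE] := derive_MVT (fun x => is_derive_trig_prim r_uniq r0 x c0) x0.
have [z /andP[xz zpi] zE] := derive_MVT (fun x => is_derive_trig_prim r_uniq r0 x c0) xpi.
exists y, z; split=> //; first exact: lt_trans xz.
  by move: yE; rewrite trig_prim0 !subr0.
by move: zE; rewrite trig_primpi sub0r.
Qed.

(** The derivative [trig_kernel r c - 1] is nondecreasing on [0, pi], so the primitive is convex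
    there and vanishes at both ends. The exponent m = 0 is included, as it occurs for the kernel of
    order p' = 0. *)
Lemma trig_prim_le0 (c : int -> R) (a : R) (m : nat) (x : R) : c 0 = 1 ->
    0 < a -> (forall y, trig_kernel r c y = a * (1 - cos y) ^+ m) ->
  0 <= x -> x <= pi -> trig_prim r c x <= 0.
Proof.
move=> c0 a0 kE; rewrite !le_eqVlt.
move=> /predU1P[<- _|x0 /predU1P[->|xpi]]; first by rewrite trig_prim0 eqxx.
  by rewrite trig_primpi eqxx.
have [y [z [y0 yz zpi yE zE]]] := trig_prim_mean_values c0 x0 xpi.
have pix : 0 < pi - x by rewrite subr_gt0.
have yzk : trig_kernel r c y <= trig_kernel r c z.
  rewrite !kE ler_pM2l// lerXn2r ?nnegrE ?one_sub_cos_ge0//.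
  by apply/ltW/one_sub_cos_mono => //; exact: ltW.
rewrite -le_eqVlt leNgt; apply/negP => s0.
have : 0 < trig_kernel r c y - 1 by rewrite -(pmulr_lgt0 _ x0) -yE.
have : trig_kernel r c z - 1 < 0 by rewrite -(pmulr_llt0 _ pix) -zE oppr_lt0.
lra.
Qed.

(** A positive exponent makes the derivative strictly increasing, hence the strict sign inside the
    interval. *)
Lemma trig_prim_lt0 (c : int -> R) (a : R) (m : nat) (x : R) : c 0 = 1 ->
    0 < a -> (forall y, trig_kernel r c y = a * (1 - cos y) ^+ m.+1) ->
  0 < x -> x < pi -> trig_prim r c x < 0.
Proof.
move=> c0 a0 kE x0 xpi.
have [y [z [y0 yz zpi yE zE]]] := trig_prim_mean_values c0 x0 xpi.
have pix : 0 < pi - x by rewrite subr_gt0.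
have yzk : trig_kernel r c y < trig_kernel r c z.
  rewrite !kE ltr_pM2l// ltrXn2r ?nnegrE ?one_sub_cos_ge0//.
  by apply/one_sub_cos_mono => //; exact: ltW.
rewrite ltNge; apply/negP => s0.
have : 0 <= trig_kernel r c y - 1 by rewrite -(pmulr_lge0 _ x0) -yE.
have : trig_kernel r c z - 1 <= 0 by rewrite -(pmulr_lle0 _ pix) -zE oppr_le0.
lra.
Qed.

Section TwoKernels.
Variables (c d : int -> R) (a b : R) (m n : nat).
Hypothesis c_even : forall k : int, c (- k) = c k.
Hypothesis d_even : forall k : int, d (- k) = d k.
Hypothesis c0 : c 0 = 1.
Hypothesis d0 : d 0 = 1.
Hypothesis a0 : 0 < a.
Hypothesis b0 : 0 < b.
Hypothesis cE : forall y, trig_kernel r c y = a * (1 - cos y) ^+ m.+1.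
Hypothesis dE : forall y, trig_kernel r d y = b * (1 - cos y) ^+ n.

(** The convolution over [-pi, pi] is folded onto [0, pi]: as [trig_prim r c] is odd, the integrand
    becomes [trig_prim r c y] times the difference of the d-kernel at x - y and at x + y. Both
    factors are nonpositive, since cos (x + y) <= cos (x - y). *)
Lemma prod_prim_ge0 (x : R) : 0 <= x -> x <= pi -> 0 <= prod_prim r c d x.
Proof.
move=> x0 xpi.
have conv_odd (y : R) : is_derive y 1 (fun z => conv_prim r c d x z - conv_prim r c d x (- z))
   (trig_prim r c y * (trig_kernel r d (x - y) - trig_kernel r d (x + y))).
  have h1 := is_derive_conv_prim r_sym c d_even x y.
  have h2 := is_derive_conv_prim r_sym c d_even x (- y).
  have h3 := @is_derive1_comp R (conv_prim r c d x) -%R y _ _ h2 (is_deriveNid y 1).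
  have := is_deriveB h1 h3.
  by rewrite trig_primN opprK !mulNr mulrN1 opprK mulrBr.
have [y /andP[y0 ypi]] := derive_MVT conv_odd (pi_gt0 R).
rewrite conv_prim_period// oppr0 subrr !subr0 => yE.
have pi0 : 0 < pi :> R := pi_gt0 R.
rewrite -(pmulr_rge0 _ (_ : 0 < 2 * pi)) ?mulr_gt0// yE.
apply: mulr_ge0; last by rewrite addr0 pi_ge0.
apply: mulr_le0; first by apply: (trig_prim_le0 c0 a0 cE) => //; exact: ltW.
rewrite subr_le0 !dE ler_pM2l// lerXn2r ?nnegrE ?one_sub_cos_ge0//.
rewrite lerD2l lerN2 cosD cosB.
have : 0 <= sin x * sin y by rewrite mulr_ge0// sin_ge0_pi ?x0// (ltW y0) ltW.
lra.
Qed.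

(** Mean value theorem for [conv_total] on [0, x]. At an interior point y the first summand of the
    derivative is negative, because the d-kernel is positive at x - y, and the second is
    nonpositive. *)
Lemma remainder_lt0 (x : R) : 0 < x -> x <= pi -> remainder r c d x < 0.
Proof.
move=> x0 xpi.
have [y /andP[y0 yx]] :=
  derive_MVT (is_derive_conv_total r_sym c d_even x) x0.
rewrite conv_total_diag// subr0 => ->.
have ypi := lt_le_trans yx xpi.
rewrite pmulr_llt0//.
apply: (@lt_le_trans _ _ (0 + 0)); last by rewrite addr0.
apply: ltr_leD; last by apply: (trig_prim_le0 d0 b0 dE) => //; exact: ltW.
rewrite nmulr_rlt0; last exact: (trig_prim_lt0 c0 a0 cE).
rewrite dE mulr_gt0// exprn_gt0//.
have := @one_sub_cos_mono 0 (x - y); rewrite cos0 subrr; apply => //.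
  by rewrite subr_gt0.
by rewrite lerBlDr (le_trans xpi)// lerDl ltW.
Qed.

(** The functions g, eta, gamma and B in terms of [tcoef]. They are linked to the method by
    [alpha_symbol], [beta_symbol], [acoef_symbol] and [bcoef_symbol]. *)
Definition symbol_g (x : R) : R :=
  - 2 * \sum_(k <- r) tcoef r c d k * (1 - cos (k%:~R * x)).
Definition symbol_eta (x : R) : R := - 2 * prod_prim r c d x.
Definition symbol_gamma (x : R) : R :=
  \sum_(k <- r) 6 * (tcoef r c d k / k%:~R + c k * d k / k%:~R ^+ 3)
                * sin (k%:~R * x).
Definition symbol_B (x : R) : R :=
  - 6 * \sum_(k <- r) tcoef r c d k
  - 6 * \sum_(k <- r) c k * d k / k%:~R ^+ 2 * cos (k%:~R * x).

Lemma symbol_g_eta (x : R) : symbol_g x - x * symbol_eta x = 2 * remainder r c d x.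
Proof. by rewrite /symbol_g /symbol_eta /remainder; ring. Qed.

Lemma symbol_eta_le0 (x : R) : 0 <= x -> x <= pi -> symbol_eta x <= 0.
Proof. by move=> ? ?; rewrite /symbol_eta mulNr oppr_le0 mulr_ge0// prod_prim_ge0. Qed.

Lemma symbol_g_lt0 (x : R) : 0 < x -> x <= pi -> symbol_g x < 0.
Proof.
move=> x0 xpi; have := symbol_g_eta x; have := remainder_lt0 x0 xpi.
have := symbol_eta_le0 (ltW x0) xpi.
have : 0 <= - symbol_eta x -> 0 <= x * - symbol_eta x by apply: mulr_ge0; exact: ltW.
lra.
Qed.

(** In gamma' + B the cosines with coefficients c_k d_k / k^2 cancel, and -6 times the sum of the
    t_k (1 - cos (k x)) remains, where t_k is [tcoef]; x B' is 6 x [prod_prim]. *)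
Lemma is_derive_symbol_gamma_B (x : R) :
  is_derive x 1 (fun y => symbol_gamma y + y * symbol_B y) (6 * remainder r c d x).
Proof.
have dgamma : is_derive x 1 symbol_gamma (\sum_(k <- r)
    6 * (tcoef r c d k / k%:~R + c k * d k / k%:~R ^+ 3)
      * (k%:~R * cos (k%:~R * x))).
  apply: (is_derive_sum_seq _) => k; apply: is_deriveZ.
  have := is_derive_sin_affine k%:~R 0 x.
  by rewrite addr0; under eq_fun do rewrite addr0.
have dcos : is_derive x 1
    (fun y => \sum_(k <- r) c k * d k / k%:~R ^+ 2 * cos (k%:~R * y))
    (\sum_(k <- r) c k * d k / k%:~R ^+ 2 * - (k%:~R * sin (k%:~R * x))).
  apply: (is_derive_sum_seq _) => k; apply: is_deriveZ.
  have := is_derive_cos_affine k%:~R 0 x.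
  by rewrite addr0; under eq_fun do rewrite addr0.
have dB : is_derive x 1 symbol_B (0 - 6 *:
    (\sum_(k <- r) c k * d k / k%:~R ^+ 2 * - (k%:~R * sin (k%:~R * x)))).
  by apply: is_deriveB; apply: is_deriveZ.
have dxB := is_deriveM (is_derive_id x 1) dB.
have h := is_deriveD dgamma dxB.
apply: (is_derive_eq h).
(* This identity and the next one survive at k = 0 because the inverse of 0 is 0. *)
have tE k : tcoef r c d k / k%:~R * k%:~R = tcoef r c d k.
  have [->|k0] := eqVneq k 0; first by rewrite /tcoef invr0 !mulr0.
  by rewrite divfK// intr_eq0.
have powE (k : int) j : k%:~R^-1 ^+ j.+2 * k%:~R = k%:~R^-1 ^+ j.+1 :> R.
  have [->|k0] := eqVneq k 0; first by rewrite invr0 mulr0 expr0n.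
  by rewrite exprSr mulfVK// intr_eq0.
have -> : \sum_(k <- r) 6 * (tcoef r c d k / k%:~R + c k * d k / k%:~R ^+ 3)
      * (k%:~R * cos (k%:~R * x))
    = 6 * (\sum_(k <- r) tcoef r c d k * cos (k%:~R * x)
      + \sum_(k <- r) c k * d k / k%:~R ^+ 2 * cos (k%:~R * x)).
  rewrite -big_split mulr_sumr; apply: eq_bigr => k _ /=.
  rewrite -mulrA; congr (_ * _).
  rewrite mulrA [X in X * cos _]mulrDl tE -!exprVn.
  by rewrite -(mulrA (c k * d k)) powE mulrDl.
have -> : \sum_(k <- r) c k * d k / k%:~R ^+ 2 * - (k%:~R * sin (k%:~R * x))
    = - prod_prim r c d x.
  rewrite -sumrN; apply: eq_bigr => k _.
  rewrite mulrN mulrA -exprVn; congr (- (_ * _)).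
  by rewrite -(mulrA (c k * d k)) powE.
have remE : \sum_(k <- r) tcoef r c d k * (1 - cos (k%:~R * x))
    = \sum_(k <- r) tcoef r c d k - \sum_(k <- r) tcoef r c d k * cos (k%:~R * x).
  by rewrite -sumrB; apply: eq_bigr => k _; rewrite mulrBr mulr1.
rewrite sub0r /GRing.scale /= mulr1 /symbol_B /remainder remE; ring.
Qed.

Lemma symbol_gamma_B_le0 (x : R) :
  0 <= x -> x <= pi -> symbol_gamma x + x * symbol_B x <= 0.
Proof.
rewrite le_eqVlt => /predU1P[<- _|x0 xpi].
  rewrite mul0r addr0 /symbol_gamma big1// => k _.
  by rewrite mulr0 sin0 mulr0.
have [y /andP[y0 yx]] := derive_MVT is_derive_symbol_gamma_B x0.
rewrite mul0r addr0 {2}/symbol_gamma big1 => [|k _]; last first.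
  by rewrite mulr0 sin0 mulr0.
rewrite !subr0 => ->; rewrite pmulr_lle0// pmulr_rle0//.
by apply/ltW/remainder_lt0 => //; rewrite ltW// (lt_le_trans yx).
Qed.

End TwoKernels.
End Signs.

(** * Sums over integer ranges *)

Section IntegerRanges.

Lemma sum_zrange (V : nmodType) (F : int -> V) (m n : nat) :
  \sum_(k <- zrange m n) F k
    = \sum_(0 <= i < m) F (Negz i) + \sum_(0 <= i < n) F (Posz i).
Proof.
rewrite /zrange big_map -{1}[(m + n)%N]subn0.
rewrite (big_cat_nat (leq0n m) (leq_addr n m)) /=; congr (_ + _).
  rewrite big_nat_rev /= !big_nat; apply: eq_bigr => i /andP[_ im].
  congr F; lia.
rewrite -{1}[m]add0n big_addn addKn; apply: eq_bigr => i _.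
by congr F; lia.
Qed.

Lemma mem_zrange (m n : nat) (k : int) :
  (k \in zrange m n) = (- m%:Z <= k < n%:Z).
Proof.
apply/mapP/idP => [[j] + ->|/andP[mk kn]]; first by rewrite mem_iota; lia.
by exists (absz (k + m%:Z)); rewrite ?mem_iota; lia.
Qed.

Lemma zrange_uniq (m n : nat) : uniq (zrange m n).
Proof. by rewrite map_inj_uniq ?iota_uniq// => i j; lia. Qed.

Lemma zrange_sym (m : nat) : perm_eq [seq - k | k <- zrange m m.+1] (zrange m m.+1).
Proof.
apply: uniq_perm; first by rewrite map_inj_uniq ?zrange_uniq//; exact: oppr_inj.
  exact: zrange_uniq.
move=> k; apply/mapP/idP => [[j] + ->|].
  by rewrite !mem_zrange; lia.
by rewrite mem_zrange => km; exists (- k); rewrite ?opprK// mem_zrange; lia.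
Qed.

Lemma zrange0 (m : nat) : 0 \in zrange m m.+1.
Proof. by rewrite mem_zrange; lia. Qed.

Lemma sum_zrange_sym (V : nmodType) (F : int -> V) (m : nat) :
  \sum_(k <- zrange m m.+1) F k
    = F 0 + \sum_(1 <= i < m.+1) (F (Posz i) + F (- Posz i)).
Proof.
rewrite sum_zrange big_nat_recl// big_add1 /= big_split /=.
by rewrite [LHS]addrC -addrA.
Qed.

(** Brings the sums of orders p' and p to one common index range. *)
Lemma sum_zrange_widen (V : nmodType) (F : int -> V) (m n : nat) :
    (m <= n)%N -> (forall k : int, (m < absz k)%N -> F k = 0) ->
  \sum_(k <- zrange n n.+1) F k = \sum_(k <- zrange m m.+1) F k.
Proof.
move=> mn F0; rewrite !sum_zrange_sym; congr (_ + _).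
rewrite (big_cat_nat (ltn0Sn m) (mn : (m.+1 <= n.+1)%N)) /= [X in _ + X]big_nat_cond [X in _ + X]big1 ?addr0//.
by move=> i; rewrite andbT => /andP[mi _]; rewrite !F0 ?addr0//; lia.
Qed.

End IntegerRanges.

(** * Alternating binomial sums *)

Section BinomialSums.
Set Implicit Arguments.
Unset Strict Implicit.
Variable R : realType.

Lemma alternating_bin_cosS (n : nat) (x y : R) :
  \sum_(0 <= i < n.+2) (-1) ^+ i * 'C(n.+1, i)%:R * cos (x + i%:R * y)
  = \sum_(0 <= i < n.+1) (-1) ^+ i * 'C(n, i)%:R * cos (x + i%:R * y)
  - \sum_(0 <= i < n.+1) (-1) ^+ i * 'C(n, i)%:R * cos (x + y + i%:R * y).
Proof.
rewrite big_nat_recl// bin0 -sumrN.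
under eq_bigr => i _ do rewrite binS natrD mulrDr mulrDl.
rewrite big_split /= addrA; congr (_ + _).
  rewrite [in RHS]big_nat_recl// bin0; congr (_ + _).
  by rewrite big_nat_recr//= bin_small// mulr0 mul0r addr0.
apply: eq_bigr => i _; rewrite exprS -natr1 !mulN1r !mulNr; congr (- (_ * cos _)).
by ring.
Qed.

(** Real part of exp (i x) (1 - exp (i y))^(2 p), where (1 - exp (i y))^2 = -2 (1 - cos y) exp (i
    y). Each induction step applies Pascal's rule twice and meets a second difference of cosines. *)
Lemma alternating_bin_cos (p : nat) (x y : R) :
  \sum_(0 <= i < (p.*2).+1) (-1) ^+ i * 'C(p.*2, i)%:R * cos (x + i%:R * y)
  = (- 2 * (1 - cos y)) ^+ p * cos (x + p%:R * y).
Proof.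
elim: p x => [|p IHp] x; first by rewrite big_nat1 bin0 !expr0 !mul1r.
rewrite doubleS !alternating_bin_cosS !IHp exprS -[p.+1%:R]natr1.
have -> : x + y + y + p%:R * y = (x + y + p%:R * y) + y by ring.
have -> : x + p%:R * y = (x + y + p%:R * y) - y by ring.
have -> : x + (p%:R + 1) * y = x + y + p%:R * y by ring.
set a := x + y + p%:R * y.
by rewrite (cosB a) (cosD a); ring.
Qed.

(** For i >= 1, C(n+1, i) / i = C(n, i) / i + C(n+1, i) / (n+1). The alternating sum of C(n+1, i)
    over all i vanishes, so leaving out i = 0 contributes -1 / (n+1). *)
Lemma alternating_bin_harmonic (n : nat) :
  \sum_(0 <= i < n.+1) (-1) ^+ i * 'C(n, i)%:R / i%:R = - harmonic_number R n.
Proof.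
rewrite /harmonic_number; elim: n => [|n IHn].
  by rewrite big_nat1 invr0 mulr0 big_geq// oppr0.
rewrite [in RHS]big_nat_recr//= opprD -IHn.
have n1 : n.+1%:R != 0 :> R by rewrite pnatr_eq0.
have step i : (-1) ^+ i * 'C(n.+1, i)%:R / i%:R = (-1) ^+ i * 'C(n, i)%:R / i%:R
  + ((-1) ^+ i * 'C(n.+1, i)%:R / n.+1%:R - (i == 0)%:R / n.+1%:R) :> R.
  case: i => [|i]; first by rewrite bin0 invr0 mulr0 expr0 !mul1r subrr addr0 mulr0.
  have i1 : i.+1%:R != 0 :> R by rewrite pnatr_eq0.
  have H : i.+1%:R * 'C(n.+1, i.+1)%:R = n.+1%:R * 'C(n, i)%:R :> R.
    by rewrite -!natrM mul_bin_diag.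
  have H2 : 'C(n.+1, i.+1)%:R = 'C(n, i.+1)%:R + 'C(n, i)%:R :> R by rewrite binS natrD.
  rewrite mul0r subr0; apply: (mulIf i1); rewrite mulrDl !divfK//.
  rewrite {1}H2 !mulrDr; congr (_ + _).
  apply: (mulIf n1); rewrite [RHS]mulrAC divfK// -!mulrA; congr (_ * _).
  by rewrite mulrC -H mulrC.
under eq_bigr do rewrite step.
rewrite big_split /= big_nat_recr //= bin_small// mulr0 mul0r addr0; congr (_ + _).
rewrite sumrB [X in _ - X]big_nat_recl//= [X in _ - (_ + X)]big1 ?addr0 ?mul1r//; last first.
  by move=> i _; rewrite mul0r.
rewrite -mulr_suml.
have -> : \sum_(0 <= i < n.+2) (-1) ^+ i * 'C(n.+1, i)%:R = 0 :> R.
  transitivity ((1 - 1 : R) ^+ n.+1); last by rewrite subrr expr0n.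
  rewrite exprBn big_mkord; apply: eq_bigr => i _.
  by rewrite !expr1n !mulr1 mulr_natr.
by rewrite mul0r sub0r.
Qed.

End BinomialSums.

(** * Residue weights, their kernels and their pole sums *)

Section Weights.
Set Implicit Arguments.
Unset Strict Implicit.
Variable R : realType.

(** C_m^{p,p}, set to 0 beyond m = p, where the truncated p - m would give a spurious value. *)
Definition central_weight (p m : nat) : R :=
  if (m <= p)%N then p`!%:R ^+ 2 / ((p + m)`!%:R * (p - m)`!%:R) else 0.

(* The residues of 1 / (x (1 - x^2 / 1^2) ... (1 - x^2 / p^2)). *)
Definition weight (p : nat) (k : int) : R :=
  (-1) ^+ absz k * central_weight p (absz k).

Lemma fact_neq0 n : n`!%:R != 0 :> R.
Proof. by rewrite pnatr_eq0 -lt0n fact_gt0. Qed.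

Lemma weightN p (k : int) : weight p (- k) = weight p k.
Proof. by rewrite /weight abszN. Qed.

Lemma weight0 p : weight p 0 = 1.
Proof.
rewrite /weight /central_weight /= expr0 addn0 subn0 -expr2 divff ?mulr1//.
by rewrite expf_neq0 ?fact_neq0.
Qed.

Lemma weight_out p (k : int) : (p < absz k)%N -> weight p k = 0.
Proof. by move=> pk; rewrite /weight /central_weight leqNgt pk mulr0. Qed.

Lemma Ccoef_opp p (k : int) : Ccoef R p p (- k) = Ccoef R p p k.
Proof. by rewrite /Ccoef opprK [X in _ / X]mulrC. Qed.

Lemma Ccoef_central p m : (m <= p)%N -> Ccoef R p p m = central_weight p m.
Proof.
move=> mp; rewrite /central_weight mp /Ccoef expr2.
by rewrite (_ : absz (p%:Z - m%:Z) = (p - m)%N); last lia.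
Qed.

Lemma weightM p p' (m : nat) : (m <= p)%N -> (m <= p')%N ->
  weight p m * weight p' m = Ccoef R p p m * Ccoef R p' p' m.
Proof.
move=> mp mp'; rewrite /weight !Ccoef_central// mulrACA -exprMn mulrNN mulr1.
by rewrite expr1n mul1r.
Qed.

(** Passing from order p + 1 to order p multiplies the rational function by 1 - x^2 / (p+1)^2, hence
    its residue at k by 1 - k^2 / (p+1)^2. *)
Lemma weightS p (k : int) :
  p.+1%:R ^+ 2 * weight p k = (p.+1%:R ^+ 2 - k%:~R ^+ 2) * weight p.+1 k.
Proof.
wlog: k / 0 <= k.
  move=> H; have [/H//|k0] := leP 0 k.
  by rewrite -(weightN p) -(weightN p.+1) -[k%:~R ^+ 2]sqrrN -mulrNz H// oppr_ge0 ltW.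
case: k => // m _; rewrite /weight /central_weight /= -pmulrn.
rewrite mulrCA [RHS]mulrCA; congr (_ * _).
have [mp|pm|->] := ltngtP m p.+1.
- rewrite -ltnS mp subSn ?addSn ?factS; last by [].
  have pm : p.+1%:R = m%:R + (p - m).+1%:R :> R by rewrite -natrD; congr (_%:R); lia.
  have pm' : (p + m).+1%:R = p.+1%:R + m%:R :> R by rewrite -natrD; congr (_%:R); lia.
  have h1 := fact_neq0 (p + m); have h2 := fact_neq0 (p - m).
  have h3 : (p - m).+1%:R != 0 :> R by rewrite pnatr_eq0.
  have h4 : (p + m).+1%:R != 0 :> R by rewrite pnatr_eq0.
  have -> : p.+1%:R ^+ 2 - m%:R ^+ 2 = (p - m).+1%:R * (p + m).+1%:R :> R.
    by rewrite pm' pm; ring.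
  rewrite !natrM; move: h1 h2 h3 h4.
  move: (p + m)`!%:R (p - m)`!%:R (p - m).+1%:R (p + m).+1%:R => a b u v.
  by move=> a0 b0 u0 v0; field; rewrite a0 b0 u0 v0.
- by rewrite leqNgt (ltn_trans (ltnSn p) pm) !mulr0.
- by rewrite ltnn subrr mul0r mulr0.
Qed.

Lemma bin_central_neq0 p : 'C(p.*2, p)%:R != 0 :> R.
Proof. by rewrite pnatr_eq0 -lt0n bin_gt0 -addnn leq_addr. Qed.

(** Recognises the weights as a centred alternating row of Pascal's triangle, which makes the
    binomial sums applicable. *)
Lemma weight_shift p (i : nat) : (i <= p.*2)%N ->
  weight p (i%:Z - p%:Z) = (-1) ^+ p * ((-1) ^+ i * 'C(p.*2, i)%:R) / 'C(p.*2, p)%:R.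
Proof.
move=> ip.
have binE m : (m <= p)%N -> central_weight p m = 'C(p.*2, p + m)%:R / 'C(p.*2, p)%:R.
  move=> mp; rewrite /central_weight mp.
  have e1 : 'C(p.*2, p + m)%:R * ((p + m)`!%:R * (p - m)`!%:R) = (p.*2)`!%:R :> R.
    rewrite -!natrM -(@bin_fact p.*2 (p + m)); last by lia.
    by congr (_ * (_ * _`!))%N%:R; lia.
  have e2 : 'C(p.*2, p)%:R * p`!%:R ^+ 2 = (p.*2)`!%:R :> R.
    rewrite -natrX -natrM -(@bin_fact p.*2 p); last by lia.
    by congr (_ * (_ * _`!))%N%:R; lia.
  have h0 : (p + m)`!%:R * (p - m)`!%:R != 0 :> R by rewrite mulf_neq0 ?fact_neq0.
  apply/eqP; rewrite eqr_div ?bin_central_neq0//; apply/eqP.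
  by rewrite mulrC e2 e1.
rewrite /weight; have [pi|pi] := leqP p i.
  rewrite (_ : absz _ = (i - p)%N); last by lia.
  rewrite binE; last by lia.
  rewrite subnKC// [LHS]mulrA; congr (_ / _); rewrite [RHS]mulrA; congr (_ * _).
  rewrite -[i in RHS](subnKC pi) exprD mulrA -expr2 sqrr_sign mul1r.
  by [].
rewrite (_ : absz _ = (p - i)%N); last by lia.
rewrite binE; last by lia.
rewrite -bin_sub; last by lia.
rewrite (_ : (p.*2 - (p + (p - i)))%N = i); last by lia.
rewrite [LHS]mulrA; congr (_ / _); rewrite [RHS]mulrA; congr (_ * _).
rewrite -[p in RHS](subnK (ltnW pi)) exprD -mulrA -expr2 sqrr_sign mulr1.
by [].
Qed.

Section Range.
Variable M : nat.
Local Notation r := (zrange M M.+1).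

(** This is [alternating_bin_cos] with initial phase -p x, which cancels the central phase p x; the
    two signs (-1)^p cancel as well. *)
Lemma weight_kernel p (x : R) : (p <= M)%N ->
  trig_kernel r (weight p) x = 2 ^+ p / 'C(p.*2, p)%:R * (1 - cos x) ^+ p.
Proof.
move=> pM; rewrite /trig_kernel (@sum_zrange_widen _ _ p)//; last first.
  by move=> k pk; rewrite weight_out// mul0r.
rewrite /zrange big_map addnS addnn.
transitivity ((-1) ^+ p / 'C(p.*2, p)%:R * \sum_(0 <= i < p.*2.+1)
    (-1) ^+ i * 'C(p.*2, i)%:R * cos (- (p%:R * x) + i%:R * x)).
  rewrite mulr_sumr /index_iota subn0 !big_seq; apply: eq_bigr => i.
  rewrite mem_iota add0n => /andP[_ ip].
  have -> : (i%:Z - p%:Z)%:~R * x = - (p%:R * x) + i%:R * x.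
    by rewrite intrB -!pmulrn; ring.
  rewrite weight_shift//; ring.
rewrite alternating_bin_cos addNr cos0 mulr1 exprMn [(- 2) ^+ p]exprNn.
have : (-1) ^+ p * (-1) ^+ p = 1 :> R by rewrite -expr2 sqrr_sign.
set e := (-1) ^+ p => ee.
transitivity (e * e * (2 ^+ p / 'C(p.*2, p)%:R * (1 - cos x) ^+ p)); first by ring.
by rewrite ee mul1r.
Qed.

Lemma weight_kernel_gt0 p : 0 < 2 ^+ p / 'C(p.*2, p)%:R :> R.
Proof. by rewrite divr_gt0 ?exprn_gt0// ltr0n bin_gt0 -addnn leq_addr. Qed.

Lemma sum_weight p : (p < M)%N -> \sum_(k <- r) weight p.+1 k = 0.
Proof.
move=> pM; have := weight_kernel 0 pM.
rewrite cos0 subrr expr0n mulr0 /trig_kernel.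
by under eq_bigr do rewrite mulr0 cos0 mulr1.
Qed.

(** Induction on p: dividing [weightS] by k^2 leaves the sum of [weight p.+1] over k != 0, which is
    -1 because the total weight vanishes. *)
Lemma sum_weight_sqr p : (p <= M)%N ->
  \sum_(k <- r) weight p k / k%:~R ^+ 2 = - \sum_(1 <= k < p.+1) k%:R ^- 2.
Proof.
elim: p => [_|p IHp pM].
  rewrite big_geq// oppr0 big1// => k _.
  have [->|k0] := eqVneq k 0; first by rewrite expr0n invr0 mulr0.
  by rewrite weight_out ?mul0r//; lia.
have p1 : p.+1%:R ^+ 2 != 0 :> R by rewrite expf_neq0 ?pnatr_eq0.
rewrite big_nat_recr//= opprD -(IHp (ltnW pM)).
apply: (mulfI p1); rewrite mulrDr mulrN divff//.
rewrite !mulr_sumr.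
have := sum_weight pM; rewrite (bigD1_seq 0) ?zrange0 ?zrange_uniq//= weight0.
move=> /eqP; rewrite addrC addr_eq0 => /eqP <-.
rewrite (bigD1_seq 0) ?zrange0 ?zrange_uniq//= expr0n invr0 !mulr0 add0r.
rewrite [X in _ = X + _](bigD1_seq 0) ?zrange0 ?zrange_uniq//= expr0n invr0 !mulr0 add0r.
rewrite -big_split /=; apply: eq_bigr => k k0.
have k0' : k%:~R != 0 :> R by rewrite intr_eq0.
rewrite [X in _ = X + _]mulrA weightS; field; exact: k0'.
Qed.

(** Here (p+1)^2 - l^2 = ((p+1)^2 - k^2) + (k - l) (k + l). The sum over l of (k + l)
    [weight p.+1 l] vanishes, and its term l = k, absent from the pole sum, produces the last
    summand. *)
Lemma pole_sum_weightS p (k : int) : (p < M)%N -> k \in r ->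
  p.+1%:R ^+ 2 * pole_sum r (weight p) k
    = (p.+1%:R ^+ 2 - k%:~R ^+ 2) * pole_sum r (weight p.+1) k
      + 2 * k%:~R * weight p.+1 k.
Proof.
move=> pM kr; rewrite /pole_sum !mulrN !mulr_sumr.
have : \sum_(l <- r) (k%:~R + l%:~R) * weight p.+1 l = 0.
  under eq_bigr do rewrite mulrDl.
  rewrite big_split /= -mulr_sumr sum_weight// mulr0 add0r.
  apply: (sum_odd (zrange_sym M)) => l.
  by rewrite weightN mulrNz mulNr.
rewrite (bigD1_seq k) ?zrange_uniq//= => /eqP; rewrite addr_eq0 => /eqP H.
rewrite (_ : 2 * _ * _ = (k%:~R + k%:~R) * weight p.+1 k); last by ring.
rewrite H -opprD; congr (- _).
rewrite (bigD1_seq k) ?zrange_uniq//= subrr invr0 !mulr0 add0r.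
rewrite [X in _ = X + _](bigD1_seq k) ?zrange_uniq//= subrr invr0 !mulr0 add0r.
rewrite -big_split; apply: eq_bigr => l lk /=.
rewrite [LHS]mulrA weightS.
have : (k - l)%:~R != 0 :> R by rewrite intr_eq0 subr_eq0 eq_sym.
by rewrite intrB => kl; field.
Qed.

(** After the reflection of l and a shift by p the denominators are 0, ..., 2 p, so that
    [alternating_bin_harmonic] applies. *)
Lemma pole_sum_weight_last p : (p <= M)%N ->
  pole_sum r (weight p) p = weight p p * harmonic_number R p.*2.
Proof.
move=> pM; rewrite /pole_sum (@sum_zrange_widen _ _ p)//; last first.
  by move=> k pk; rewrite weight_out// mul0r.
rewrite -(sum_opp (zrange_sym p)) /zrange big_map addnS addnn.
transitivity (- ((-1) ^+ p / 'C(p.*2, p)%:R * \sum_(0 <= i < p.*2.+1)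
    (-1) ^+ i * 'C(p.*2, i)%:R / i%:R) : R).
  rewrite mulr_sumr /index_iota subn0 !big_seq; congr (- _); apply: eq_bigr => i.
  rewrite mem_iota add0n => /andP[_ ip].
  rewrite weightN weight_shift//.
  rewrite (_ : p%:Z - - (i%:Z - p%:Z) = i%:Z); last by lia.
  by rewrite -pmulrn; ring.
rewrite alternating_bin_harmonic mulrN opprK; congr (_ * _).
have := @weight_shift p p.*2 (leqnn _).
rewrite (_ : p.*2%:Z - p%:Z = p%:Z); last by lia.
move=> ->; rewrite binn mulr1 -[p.*2]addnn exprD -expr2 sqrr_sign mulr1.
by [].
Qed.

(** Up to sign, the constant term of the Laurent expansion of the rational function at its pole k.
    By induction from p = k, both sides obey the recursion [pole_sum_weightS]. *)
Lemma pole_sum_weight p (k : nat) : (0 < k)%N -> (k <= p)%N -> (p <= M)%N ->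
  pole_sum r (weight p) k = weight p k * zeta R p p k.
Proof.
move=> k0; elim: p => [|p IHp]; first by case: k k0.
rewrite leq_eqVlt => /predU1P[->|kp] pM.
  rewrite pole_sum_weight_last// /zeta subrr /= /harmonic_number [X in _ - X]big_geq// subr0.
  by rewrite addnn.
have kr : k%:Z \in r by rewrite mem_zrange; lia.
have := pole_sum_weightS pM kr; rewrite (IHp kp (ltnW pM)) mulrA weightS.
rewrite -pmulrn.
have pk0 : p.+1%:R ^+ 2 - k%:R ^+ 2 != 0 :> R.
  by rewrite subr_eq0 eqrXn2 ?ler0n// eqr_nat gtn_eqF.
have zetaE : zeta R p p k = zeta R p.+1 p.+1 k + 2 * k%:R / (p.+1%:R ^+ 2 - k%:R ^+ 2).
  rewrite /zeta.
  rewrite (_ : absz (p%:Z + k%:Z) = (p + k)%N) //.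
  rewrite (_ : absz (p.+1%:Z + k%:Z) = (p + k).+1) //.
  rewrite (_ : absz (p%:Z - k%:Z) = (p - k)%N); last by lia.
  rewrite (_ : absz (p.+1%:Z - k%:Z) = (p - k).+1); last by lia.
  have harmonicS n : harmonic_number R n.+1 = harmonic_number R n + n.+1%:R^-1.
    by rewrite /harmonic_number big_nat_recr.
  rewrite !harmonicS.
  have pk : p.+1%:R = k%:R + (p - k).+1%:R :> R by rewrite -natrD; congr (_%:R); lia.
  have pk' : (p + k).+1%:R = p.+1%:R + k%:R :> R by rewrite -natrD; congr (_%:R); lia.
  have h3 : (p - k).+1%:R != 0 :> R by rewrite pnatr_eq0.
  have h4 : (p + k).+1%:R != 0 :> R by rewrite pnatr_eq0.
  have e : p.+1%:R ^+ 2 - k%:R ^+ 2 = (p - k).+1%:R * (p + k).+1%:R :> R.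
    by rewrite pk' pk; ring.
  rewrite e.
  have -> : k%:R = ((p + k).+1%:R - (p - k).+1%:R) / 2 :> R by rewrite pk' pk; field.
  move: h3 h4; move: (p - k).+1%:R (p + k).+1%:R => u v u0 v0.
  by field; rewrite u0 v0.
rewrite {}zetaE; move: pk0; move: (p.+1%:R ^+ 2 - k%:R ^+ 2) => D D0 H.
apply: (mulfI D0); apply: (addIr (2 * k%:R * weight p.+1 k)).
by rewrite -H; field.
Qed.

(** At k = p + 1, just outside the support of [weight p], the factor (p+1)^2 - k^2 vanishes and only
    the correction term of the recursion survives. *)
Lemma pole_sum_weight_next p : (p < M)%N ->
  pole_sum r (weight p) p.+1 = 2 * weight p.+1 p.+1 / p.+1%:R.
Proof.
move=> pM; have kr : p.+1%:Z \in r by rewrite mem_zrange; lia.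
have := pole_sum_weightS pM kr; rewrite -pmulrn subrr mul0r add0r => H.
have p1 : p.+1%:R != 0 :> R by rewrite pnatr_eq0.
apply: (mulfI (expf_neq0 2 p1)); rewrite {}H.
by move: p1; move: (p.+1%:R : R) => c c0; field.
Qed.

End Range.
End Weights.

(** * The optimal coefficients expressed by residue weights *)

Section Coefficients.
Set Implicit Arguments.
Unset Strict Implicit.
Variables (R : realType) (p p' : nat).
Hypothesis p_gt0 : (0 < p)%N.
Hypothesis pp' : (p.-1 <= p' <= p)%N.
Local Notation r := (zrange p p.+1).
Local Notation c := (weight R p).
Local Notation d := (weight R p').

Lemma p'_le : (p' <= p)%N. Proof. by case/andP: pp'. Qed.

Lemma tcoef_central (k : nat) : (0 < k)%N -> (k <= p')%N ->
  tcoef r c d k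
    = (1 + k%:R * (zeta R p p k + zeta R p' p' k)) / k%:R ^+ 2
      * Ccoef R p p k * Ccoef R p' p' k.
Proof.
move=> k0 kp'; have kp := leq_trans kp' p'_le.
rewrite /tcoef !pole_sum_weight ?p'_le// -pmulrn.
rewrite -(mulrA _ (Ccoef R p p k)) -weightM//.
have k0R : (k%:R : R) != 0 by rewrite pnatr_eq0 -lt0n.
by move: k0R; move: (k%:R : R) => x x0; field.
Qed.

(** As d_p = 0, only c_p times the pole sum of d remains. *)
Lemma tcoef_last : p = p'.+1 ->
  tcoef r c d p = 1 / p%:R ^+ 2 * Ccoef R p p p * Ccoef R p' p p.
Proof.
move=> pE; rewrite /tcoef (weight_out _ (_ : (p' < absz p)%N)) ?pE//.
rewrite pole_sum_weight_next ?pE// -pmulrn.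
(* With p = p' + 1, (2 p)! / (2 p - 1)! = 2 p, and the factor p is absorbed by p! = p p'!. *)
have -> : Ccoef R p' p'.+1 p'.+1 = 2 * Ccoef R p'.+1 p'.+1 p'.+1.
  rewrite /Ccoef !subrr /= (_ : (p'.+1 + p'.+1 = (p' + p'.+1).+1)%N)//.
  have h1 := fact_neq0 R (p' + p'.+1); have h2 : (p' + p'.+1).+1%:R != 0 :> R.
    by rewrite pnatr_eq0.
  rewrite !factS !natrM fact0 mulr1 mulr1.
  have e : (p' + p'.+1).+1%:R = 2 * p'.+1%:R :> R by rewrite -natrM; congr (_%:R); lia.
  rewrite e; rewrite e in h2; move: h1 h2.
  move: (p' + p'.+1)`!%:R (p'.+1%:R : R) => x y x0 y0; field.
  by rewrite x0; move: y0; rewrite mulf_eq0 negb_or => /andP[_ ->].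
have := @weightM R p'.+1 p'.+1 p'.+1 (leqnn _) (leqnn _).
have : (p'.+1%:R : R) != 0 by rewrite pnatr_eq0.
move: (p'.+1%:R : R) (weight R p'.+1 p'.+1) (Ccoef R p'.+1 p'.+1 p'.+1) => x y z x0 yz.
transitivity (2 * (y * y) / x ^+ 2); first by field.
by rewrite yz; field.
Qed.

Lemma p'_cases : p' = p \/ p = p'.+1.
Proof. by move: pp' p_gt0; lia. Qed.

(** The factor with the Kronecker delta supplies exactly the top index k = p, which is missing when
    p' = p - 1. *)
Lemma sum_up_to_last (f : nat -> R) (n : nat) : (n < p)%N ->
  \sum_(n.+1 <= k < p.+1) f k
    = \sum_(n.+1 <= k < p'.+1) f k + (1 - (p == p')%:R) * f p.
Proof.
move=> np; case: p'_cases => [->|pE]; first by rewrite eqxx subrr mul0r addr0.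
rewrite big_nat_recr//= -pE; congr (_ + _).
by rewrite pE eqn_leq ltnn /= subr0 mul1r.
Qed.

Lemma alpha_nonnegE (n : nat) : (n < p)%N ->
  alpha_nonneg R p p' n = \sum_(n.+1 <= k < p.+1) 2 * tcoef r c d k.
Proof.
move=> np; rewrite sum_up_to_last// /alpha_nonneg; congr (_ + _).
  rewrite !big_nat; apply: eq_bigr => k /andP[nk kp'].
  by rewrite tcoef_central ?(leq_ltn_trans _ nk)// !mulrA.
case: p'_cases => [->|pE]; first by rewrite eqxx subrr !mul0r.
by rewrite tcoef_last//; ring.
Qed.

(* For 1 <= k <= p this is the jump a_{k-1} - a_k, with a_p read as 0. *)
Definition ucoef (k : int) : R :=
  6 * (tcoef r c d k / k%:~R + c k * d k / k%:~R ^+ 3).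

Lemma a_nonnegE (n : nat) : (n < p)%N ->
  a_nonneg R p p' n = \sum_(n.+1 <= k < p.+1) ucoef k.
Proof.
have p0 : (p%:R : R) != 0 by rewrite pnatr_eq0 -lt0n.
move=> np; rewrite sum_up_to_last// /a_nonneg; congr (_ + _).
  rewrite !big_nat; apply: eq_bigr => k /andP[nk kp'].
  have k0 : (0 < k)%N by rewrite (leq_ltn_trans _ nk).
  have k0R : (k%:R : R) != 0 by rewrite pnatr_eq0 -lt0n.
  rewrite /ucoef tcoef_central// weightM ?(leq_trans _ p'_le)// -pmulrn.
  by move: k0R; move: (k%:R : R) => x x0; field.
case: p'_cases => [->|pE]; first by rewrite eqxx subrr !mul0r.
rewrite /ucoef tcoef_last// (weight_out _ (_ : (p' < absz p)%N)) ?pE// -pE.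
by rewrite mulr0 mul0r addr0 -pmulrn; move: p0; move: (p%:R : R) => x x0; field.
Qed.

Lemma weightM_int (k : int) : (absz k <= p')%N ->
  Ccoef R p p k * Ccoef R p' p' k = c k * d k.
Proof.
have kp k' : (k' <= p')%N -> (k' <= p)%N by move/leq_trans; apply; exact: p'_le.
case: (intP k) => [|m|m] kp'; rewrite ?weightN ?Ccoef_opp weightM ?kp//; lia.
Qed.

Lemma betaE (k : int) : (absz k <= p')%N ->
  beta R p p' k = - 2 * (c k * d k / k%:~R).
Proof.
move=> kp'; rewrite /beta; have [->|k0] := eqVneq k 0; first by rewrite invr0 !mulr0.
by rewrite -mulrA weightM_int//; ring.
Qed.

Lemma bcoef_neq0 (k : int) : k != 0 -> (absz k <= p')%N ->
  bcoef R p p' k = - 6 * (c k * d k / k%:~R ^+ 2).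
Proof.
by move=> k0 kp'; rewrite /bcoef (negPf k0) -mulrA weightM_int//; ring.
Qed.

Lemma sum_inv_sqr (m : nat) :
  \sum_(i <- zrange m m.+1 | i != 0) 3 / i%:~R ^+ 2
    = 6 * \sum_(1 <= k < m.+1) k%:R ^- 2 :> R.
Proof.
rewrite big_mkcond sum_zrange_sym eqxx add0r mulr_sumr !big_nat.
apply: eq_bigr => k /andP[k0 _]; rewrite oppr_eq0 -lt0n k0 mulrNz sqrrN -pmulrn.
by ring.
Qed.

Lemma sum_tcoef_zrange : \sum_(k <- r) tcoef r c d k
  = \sum_(1 <= k < p.+1) k%:R ^- 2 + \sum_(1 <= k < p'.+1) k%:R ^- 2.
Proof.
rewrite sum_tcoef ?zrange_uniq ?zrange0 ?weight0//; first last.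
- exact: weightN.
- exact: zrange_sym.
by rewrite !sum_weight_sqr ?p'_le// opprD !opprK.
Qed.

Lemma bcoef0 : bcoef R p p' 0 = - 6 * \sum_(k <- r) tcoef r c d k.
Proof. by rewrite /bcoef eqxx !sum_inv_sqr sum_tcoef_zrange; ring. Qed.

(** (m + j)! (m - j)! increases strictly with j and equals (m!)^2 at j = 0. *)
Lemma central_weight_lt1 (m k : nat) : (0 < k)%N -> (k <= m)%N ->
  0 <= central_weight R m k < 1.
Proof.
move=> k0 km; rewrite /central_weight km; apply/andP; split.
  by rewrite mulr_ge0 ?exprn_ge0 ?invr_ge0 ?mulr_ge0 ?ler0n.
rewrite ltr_pdivrMr ?mulr_gt0 ?ltr0n ?fact_gt0// mul1r expr2 -!natrM ltr_nat.
have step j : (j < m)%N ->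
    ((m + j)`! * (m - j)`! < (m + j.+1)`! * (m - j.+1)`!)%N.
  move=> jm; rewrite addnS factS (_ : (m - j = (m - j.+1).+1)%N); last lia.
  rewrite factS mulnCA -[ltnRHS]mulnA.
  by rewrite ltn_pmul2r ?muln_gt0 ?fact_gt0//; lia.
case: k k0 km => // k _; elim: k => [|k IHk] km.
  by have := step 0%N km; rewrite addn0 subn0.
by apply: ltn_trans (IHk (ltnW km)) (step _ km).
Qed.

(** Pairing k with -k, B is -6 times a sum over k = 1, ..., p of 1 / k^2 and, for k <= p', of a
    further 1 / k^2 and 2 c_k d_k cos (k x) / k^2. As 0 <= c_k d_k < 1, every summand is
    positive. *)
Lemma symbol_B_lt0 (x : R) : symbol_B r c d x < 0.
Proof.
rewrite /symbol_B sum_tcoef_zrange sum_zrange_sym.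
rewrite expr0n invr0 mulr0 mul0r add0r.
have -> : \sum_(1 <= k < p'.+1) k%:R ^- 2
    = \sum_(1 <= k < p.+1) (k <= p')%:R * k%:R ^- 2 :> R.
  rewrite (big_cat_nat (ltn0Sn p') (p'_le : (p' < p.+1)%N)) /=.
  rewrite [X in _ + X]big_nat_cond [X in _ + X]big1 ?addr0 => [|k].
    by rewrite !big_nat; apply: eq_bigr => k /andP[_]; rewrite ltnS => ->; rewrite mul1r.
  by rewrite andbT ltnNge => /andP[/negPf -> _]; rewrite mul0r.
suff : 0 < \sum_(1 <= k < p.+1) (k%:R ^- 2 + (k <= p')%:R * k%:R ^- 2
    + (c k * d k / k%:~R ^+ 2 * cos (k%:~R * x)
     + c (- k%:Z) * d (- k%:Z) / (- k%:Z)%:~R ^+ 2 * cos ((- k%:Z)%:~R * x))).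
  by rewrite big_split [X in _ < X + _]big_split /=; lra.
have pos k : (0 < k)%N -> (k <= p)%N -> 0 < k%:R ^- 2 + (k <= p')%:R * k%:R ^- 2
    + (c k * d k / k%:~R ^+ 2 * cos (k%:~R * x)
     + c (- k%:Z) * d (- k%:Z) / (- k%:Z)%:~R ^+ 2 * cos ((- k%:Z)%:~R * x)).
  move=> k0 kp; rewrite !weightN mulrNz sqrrN mulNr cosN -pmulrn.
  have : 0 < k%:R ^- 2 :> R by rewrite invr_gt0 exprn_gt0// ltr0n.
  move: (k%:R ^- 2 : R) => y y0.
  have [kp'|kp'] := leqP k p'; last first.
    by rewrite (weight_out _ (_ : (p' < absz k)%N))// mulr0 !mul0r; lra.
  rewrite weightM// !Ccoef_central//.
  have /andP[a0 a1] := central_weight_lt1 k0 kp.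
  have /andP[b0 b1] := central_weight_lt1 k0 kp'.
  have ab0 := mulr_ge0 a0 b0; have ab1 := mulr_ilt1 a0 b0 a1 b1.
  move: (_ * _) ab0 ab1 => z z0 z1.
  rewrite mul1r; suff : 0 < 2 * y * (1 + z * cos (k%:R * x)) by lra.
  rewrite !mulr_gt0//.
  have : - 1 <= cos (k%:R * x) by exact: cos_geN1.
  move/(ler_wpM2l z0); lra.
rewrite big_ltn// ltr_pwDl// ?pos// big_nat_cond sumr_ge0// => k.
by rewrite andbT => /andP[k1 kp]; rewrite ltW// pos// ltnW.
Qed.

Lemma pole_sumN (k : int) m : pole_sum r (weight R m) (- k) = - pole_sum r (weight R m) k.
Proof.
rewrite /pole_sum opprK -(sum_opp (zrange_sym p)) -sumrN; apply: eq_bigr => l _.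
by rewrite weightN -opprD mulrNz invrN mulrN opprK.
Qed.

Lemma tcoefN (k : int) : tcoef r c d (- k) = tcoef r c d k.
Proof.
by rewrite /tcoef !pole_sumN !weightN mulrNz !invrN !(mulrN, mulNr) -!opprD mulNr opprK.
Qed.

Lemma symbol_gN x : symbol_g r c d (- x) = symbol_g r c d x.
Proof.
by congr (_ * _); apply: eq_bigr => k _; rewrite mulrN cosN.
Qed.

Lemma symbol_BN x : symbol_B r c d (- x) = symbol_B r c d x.
Proof.
by congr (_ - _ * _); apply: eq_bigr => k _; rewrite mulrN cosN.
Qed.

Lemma symbol_etaN x : symbol_eta r c d (- x) = - symbol_eta r c d x.
Proof.
rewrite /symbol_eta /prod_prim -mulrN -sumrN.
by congr (_ * _); apply: eq_bigr => k _; rewrite mulrN sinN mulrN.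
Qed.

Lemma symbol_gammaN x : symbol_gamma r c d (- x) = - symbol_gamma r c d x.
Proof.
by rewrite /symbol_gamma -sumrN; apply: eq_bigr => k _; rewrite mulrN sinN mulrN.
Qed.

End Coefficients.

(** * Trace and determinant of the 2 by 2 Fourier symbol *)

Section Dispersion.
Set Implicit Arguments.
Unset Strict Implicit.
Variable R : realType.

Definition central_g (p p' : nat) : R -> R :=
  symbol_g (zrange p p.+1) (weight R p) (weight R p').
Definition central_eta (p p' : nat) : R -> R :=
  symbol_eta (zrange p p.+1) (weight R p) (weight R p').
Definition central_gamma (p p' : nat) : R -> R :=
  symbol_gamma (zrange p p.+1) (weight R p) (weight R p').
Definition central_B (p p' : nat) : R -> R :=
  symbol_B (zrange p p.+1) (weight R p) (weight R p').

Definition central_tr (p p' q q' : nat) (x : R) : R :=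
  central_g p p' x + central_B q q' x.
Definition central_det (p p' q q' : nat) (x : R) : R :=
  central_g p p' x * central_B q q' x + central_eta p p' x * central_gamma q q' x.

Lemma weight_kernel_pred (p : nat) (y : R) : (0 < p)%N ->
  trig_kernel (zrange p p.+1) (weight R p) y
    = 2 ^+ p / 'C(p.*2, p)%:R * (1 - cos y) ^+ p.-1.+1.
Proof. by move=> p0; rewrite prednK// weight_kernel. Qed.

Section Stencil.
Variables p p' : nat.
Hypothesis p0 : (0 < p)%N.
Hypothesis pp' : (p.-1 <= p' <= p)%N.

Let p'p : (p' <= p)%N. Proof. by case/andP: pp'. Qed.
Let kernel_c y := @weight_kernel_pred p y p0.
Let kernel_d y := @weight_kernel R p p' y p'p.

Lemma central_g_lt0 (x : R) : 0 < x -> x <= pi -> central_g p p' x < 0.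
Proof.
exact: (symbol_g_lt0 (zrange_uniq _ _) (zrange_sym p) (zrange0 p)
  (weightN R p) (weightN R p') (weight0 R p) (weight0 R p')
  (weight_kernel_gt0 R p) (weight_kernel_gt0 R p') kernel_c kernel_d).
Qed.

Lemma central_eta_le0 (x : R) : 0 < x -> x <= pi -> central_eta p p' x <= 0.
Proof.
move=> /ltW.
exact: (symbol_eta_le0 (zrange_uniq _ _) (zrange_sym p) (zrange0 p)
  (weightN R p') (weight0 R p)
  (weight_kernel_gt0 R p) (weight_kernel_gt0 R p') kernel_c kernel_d).
Qed.

Lemma central_g_eta_lt0 (x : R) : 0 < x -> x <= pi ->
  central_g p p' x - x * central_eta p p' x < 0.
Proof.
move=> x0 xpi; rewrite /central_g /central_eta symbol_g_eta pmulr_rlt0//.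
exact: (remainder_lt0 (zrange_uniq _ _) (zrange_sym p) (zrange0 p)
  (weightN R p) (weightN R p') (weight0 R p) (weight0 R p')
  (weight_kernel_gt0 R p) (weight_kernel_gt0 R p') kernel_c kernel_d x0 xpi).
Qed.

Lemma central_gamma_B_le0 (x : R) : 0 < x -> x <= pi ->
  central_gamma p p' x + x * central_B p p' x <= 0.
Proof.
move=> /ltW.
exact: (symbol_gamma_B_le0 (zrange_uniq _ _) (zrange_sym p) (zrange0 p)
  (weightN R p) (weightN R p') (weight0 R p) (weight0 R p')
  (weight_kernel_gt0 R p) (weight_kernel_gt0 R p') kernel_c kernel_d).
Qed.

Lemma central_B_lt0 (x : R) : central_B p p' x < 0.
Proof. exact: (symbol_B_lt0 p0 pp'). Qed.

End Stencil.

Section TwoStencils.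
Variables p p' q q' : nat.
Hypothesis p0 : (0 < p)%N.
Hypothesis pp' : (p.-1 <= p' <= p)%N.
Hypothesis q0 : (0 < q)%N.
Hypothesis qq' : (q.-1 <= q' <= q)%N.

Lemma central_trN x : central_tr p p' q q' (- x) = central_tr p p' q q' x.
Proof. by rewrite /central_tr /central_g /central_B symbol_gN symbol_BN. Qed.

Lemma central_detN x : central_det p p' q q' (- x) = central_det p p' q q' x.
Proof.
rewrite /central_det /central_g /central_B /central_eta /central_gamma.
by rewrite symbol_gN symbol_BN symbol_etaN symbol_gammaN mulrNN.
Qed.

(** Trace and determinant are even, so x > 0 may be assumed. In the splitting of the determinant the
    first product is positive and the second nonnegative. *)
Lemma central_stable (x : R) : x != 0 -> `|x| <= pi ->
  central_tr p p' q q' x < 0 /\ 0 < central_det p p' q q' x.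
Proof.
wlog x0 : x / 0 < x.
  move=> H x0; have [xge0|xlt0] := leP 0 x.
    by apply: H => //; rewrite lt_neqAle eq_sym x0.
  rewrite -central_trN -central_detN -normrN.
  by apply: H; rewrite ?oppr_gt0 ?oppr_eq0.
move=> _; rewrite gtr0_norm// => xpi.
have g0 := central_g_lt0 p0 pp' x0 xpi.
have B0 := central_B_lt0 q0 qq' x.
split; first by rewrite /central_tr; lra.
have -> : central_det p p' q q' x
    = central_B q q' x * (central_g p p' x - x * central_eta p p' x)
      + central_eta p p' x * (central_gamma q q' x + x * central_B q q' x).
  by rewrite /central_det; ring.
apply: ltr_pwDl.
  by rewrite nmulr_rgt0// central_g_eta_lt0.
by rewrite mulr_le0 ?central_eta_le0 ?central_gamma_B_le0.
Qed.

Lemma central_g0 : central_g p p' 0 = 0.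
Proof.
rewrite /central_g /symbol_g big1 ?mulr0// => k _.
by rewrite mulr0 cos0 subrr mulr0.
Qed.

Lemma central_eta0 : central_eta p p' 0 = 0.
Proof.
rewrite /central_eta /symbol_eta /prod_prim big1 ?mulr0// => k _.
by rewrite mulr0 sin0 mulr0.
Qed.

End TwoStencils.

(** * Points of the unit circle and sums of their powers *)

Definition expi (x : R) : R[i] := Complex (cos x) (sin x).

Lemma expiD x y : expi (x + y) = expi x * expi y.
Proof. by apply/eqP; rewrite eq_complex /= cosD sinD addrC eqxx /= addrC mulrC eqxx. Qed.

Lemma expi0 : expi 0 = 1.
Proof. by rewrite /expi cos0 sin0. Qed.

Lemma expi_unit x : expi x \is a GRing.unit.
Proof. by apply/unitrPr; exists (expi (- x)); rewrite -expiD subrr expi0. Qed.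

Lemma expiV x : (expi x)^-1 = expi (- x).
Proof. by apply: (mulrI (expi_unit x)); rewrite divrr ?expi_unit// -expiD subrr expi0. Qed.

Lemma expi_exprz x (k : int) : expi x ^ k = expi (k%:~R * x).
Proof.
have expi_exprn n : expi x ^+ n = expi (n%:R * x).
  elim: n => [|n IHn]; first by rewrite mul0r expi0.
  by rewrite exprSr IHn -expiD -natr1 mulrDl mul1r.
case: k => n; first by rewrite -exprnP expi_exprn.
by rewrite NegzE -exprnN expi_exprn expiV mulrNz mulNr.
Qed.

(** The angle is acos of the real part, negated when the imaginary part is negative. *)
Lemma norm1_expi (z : R[i]) : complex.Re z ^+ 2 + complex.Im z ^+ 2 = 1 ->
  exists2 x, z = expi x & `|x| <= pi.
Proof.
case: z => a b /= ab1.
have a1 : -1 <= a <= 1.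
  by rewrite -ler_norml -(@expr_le1 _ 2)// real_normK ?num_real// -ab1 lerDl sqr_ge0.
have acos_bound : `|acos a| <= pi by rewrite ger0_norm ?acos_ge0// acos_lepi.
have sin_acosE : sin (acos a) = `|b|.
  by rewrite sin_acos// -ab1 [X in X - _]addrC addrK sqrtr_sqr.
have cos_acosE : cos (acos a) = a by rewrite acosK// in_itv /= a1.
have [b0|b0] := leP 0 b.
  by exists (acos a); rewrite // /expi cos_acosE sin_acosE ger0_norm.
exists (- acos a); last by rewrite normrN.
rewrite /expi cosN sinN cos_acosE sin_acosE.
by rewrite ltr0_norm// opprK.
Qed.

Local Notation toC := (real_complex R).

Lemma sum_even_expi (r : seq int) (f : int -> R) (x : R) :
    perm_eq [seq - k | k <- r] r -> (forall k : int, f (- k) = f k) ->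
  \sum_(k <- r) toC (f k) * expi x ^ k = toC (\sum_(k <- r) f k * cos (k%:~R * x)).
Proof.
move=> r_sym f_even; have sin_sum0 : \sum_(k <- r) f k * sin (k%:~R * x) = 0.
  by apply: (sum_odd r_sym) => k; rewrite f_even mulrNz mulNr sinN mulrN.
transitivity (Complex (\sum_(k <- r) f k * cos (k%:~R * x))
                      (\sum_(k <- r) f k * sin (k%:~R * x))).
  elim: r {r_sym sin_sum0} => [|k r IHr]; first by rewrite !big_nil.
  rewrite !big_cons IHr expi_exprz; apply/eqP.
  by rewrite eq_complex /= !mul0r subr0 addr0 !eqxx.
by rewrite sin_sum0.
Qed.

Lemma sum_odd_expi (r : seq int) (f : int -> R) (x : R) :
    perm_eq [seq - k | k <- r] r -> (forall k : int, f (- k) = - f k) ->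
  \sum_(k <- r) toC (f k) * expi x ^ k = 'i%C * toC (\sum_(k <- r) f k * sin (k%:~R * x)).
Proof.
move=> r_sym f_odd; have cos_sum0 : \sum_(k <- r) f k * cos (k%:~R * x) = 0.
  by apply: (sum_odd r_sym) => k; rewrite f_odd mulrNz !mulNr cosN.
transitivity (Complex (\sum_(k <- r) f k * cos (k%:~R * x))
                      (\sum_(k <- r) f k * sin (k%:~R * x))).
  elim: r {r_sym cos_sum0} => [|k r IHr]; first by rewrite !big_nil.
  rewrite !big_cons IHr expi_exprz; apply/eqP.
  by rewrite eq_complex /= !mul0r subr0 addr0 !eqxx.
rewrite cos_sum0; apply/eqP.
by rewrite eq_complex /= !mul0r mulr0 subr0 mul1r add0r !eqxx.
Qed.

End Dispersion.

(** * Summation by parts for Laurent sums *)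

Section SummationByParts.
Set Implicit Arguments.
Unset Strict Implicit.
Variable F : fieldType.

Lemma sum_tails (T u : nat -> F) (p : nat) :
  \sum_(0 <= n < p) (\sum_(n.+1 <= k < p.+1) T k) * u n
    = \sum_(1 <= k < p.+1) T k * \sum_(0 <= n < k) u n.
Proof.
elim: p => [|p IHp]; first by rewrite !big_geq.
rewrite [RHS]big_nat_recr//= -IHp mulr_sumr [X in _ = X + _](_ : _ =
    \sum_(0 <= n < p.+1) (\sum_(n.+1 <= k < p.+1) T k) * u n); last first.
  by rewrite [RHS]big_nat_recr//= [X in _ = _ + X * _]big_geq// mul0r addr0.
rewrite -big_split !big_nat; apply: eq_bigr => n /andP[_ np] /=.
by rewrite big_nat_recr//= mulrDl.
Qed.

(** As A is a tail sum of T, multiplication by z - 1 makes the powers of z telescope. The factor e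
    is the parity of A under the exchange of k and -1 - k: -1 for alpha and 1 for a. *)
Lemma summation_by_parts (e z : F) (A : int -> F) (T : nat -> F) (p : nat) :
    z != 0 ->
    (forall n, (n < p)%N -> A (Posz n) = \sum_(n.+1 <= k < p.+1) T k) ->
    (forall n, (n < p)%N -> A (Negz n) = e * A (Posz n)) ->
  (z - 1) * \sum_(k <- zrange p p) A k * z ^ k
    = \sum_(1 <= k < p.+1) T k * ((z ^ k%:Z - 1) + e * (1 - z ^ (- k%:Z))).
Proof.
move=> z0 AP AN; rewrite sum_zrange -big_split mulr_sumr /=.
transitivity (\sum_(0 <= n < p) (\sum_(n.+1 <= k < p.+1) T k)
   * ((z ^+ n.+1 - z ^+ n) + e * (z ^- n - z ^- n.+1))).
  rewrite !big_nat; apply: eq_bigr => n /andP[_ np].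
  rewrite AN// AP// NegzE -exprnN -exprnP.
  have -> : z ^- n = z * z ^- n.+1 by rewrite exprS invfM mulVKf.
  by rewrite exprS; ring.
rewrite sum_tails; apply: eq_bigr => k _; congr (_ * _).
rewrite -exprnN -exprnP big_split -mulr_sumr /= telescope_sumr// expr0.
congr (_ + _ * _); have := telescope_sumr (fun n => z ^- n) (leq0n k).
rewrite expr0 invr1 => tele; rewrite -[RHS]opprB -tele -sumrN.
by apply: eq_bigr => n _; rewrite opprB.
Qed.

End SummationByParts.

(** * Fourier symbols of the four Laurent polynomials *)

Section Symbols.
Set Implicit Arguments.
Unset Strict Implicit.
Variables (R : realType) (p p' : nat).
Hypothesis p0 : (0 < p)%N.
Hypothesis pp' : (p.-1 <= p' <= p)%N.
Local Notation toC := (real_complex R).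
Local Notation c := (weight R p).
Local Notation d := (weight R p').

Definition laurent_symbol (a : int -> R) (m m' : nat) (z : R[i]) : R[i] :=
  \sum_(k <- zrange m m') toC (a k) * z ^ k.

Let p'p : (p' <= p)%N. Proof. by case/andP: pp'. Qed.

Lemma expi_neq0 (x : R) : expi x != 0.
Proof. by rewrite -unitfE expi_unit. Qed.

Lemma alpha_symbol (x : R) :
  (expi x - 1) * laurent_symbol (alpha R p p') p p (expi x)
    = toC (central_g p p' x).
Proof.
set T := fun k : int => 2 * tcoef (zrange p p.+1) c d k.
rewrite (@summation_by_parts _ (- 1) _ (fun k => toC (alpha R p p' k)) (fun k => toC (T k))).
- transitivity (\sum_(k <- zrange p p.+1) toC (T k) * expi x ^ k
      - \sum_(k <- zrange p p.+1) toC (T k) * expi x ^ 0).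
    rewrite -sumrB sum_zrange_sym subrr add0r; apply: eq_bigr => k _.
    by rewrite /T tcoefN expr0z; ring.
  rewrite sum_even_expi; last 2 first.
  - exact: zrange_sym.
  - by move=> k; rewrite /T tcoefN.
  rewrite expr0z -mulr_suml mulr1 -rmorph_sum -rmorphB -sumrB; congr toC.
  rewrite /central_g /symbol_g mulr_sumr; apply: eq_bigr => k _.
  by rewrite /T; ring.
- exact: expi_neq0.
- by move=> n np; rewrite /= (alpha_nonnegE _ p0 pp')// rmorph_sum.
- by move=> n np; rewrite /= rmorphN mulN1r.
Qed.

Lemma ucoefN (k : int) : ucoef R p p' (- k) = - ucoef R p p' k.
Proof.
rewrite /ucoef tcoefN !weightN mulrNz !invrN mulrN -exprVn invrN.
by rewrite [(- _) ^+ 3]exprNn -exprVn -signr_odd /=; ring.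
Qed.

Lemma acoef_symbol (x : R) :
  (expi x - 1) * laurent_symbol (acoef R p p') p p (expi x)
    = 'i%C * toC (central_gamma p p' x).
Proof.
rewrite (@summation_by_parts _ 1 _ (fun k => toC (acoef R p p' k))
  (fun k => toC (ucoef R p p' k))).
- rewrite -(sum_odd_expi _ (zrange_sym p) ucoefN) sum_zrange_sym.
  have -> : ucoef R p p' 0 = 0 by rewrite /ucoef expr0n invr0 !mulr0 addr0 mulr0.
  rewrite rmorph0 mul0r add0r.
  apply: eq_bigr => k _; rewrite ucoefN rmorphN /=; ring.
- exact: expi_neq0.
- by move=> n np; rewrite /= (a_nonnegE _ p0 pp')// rmorph_sum.
- by move=> n np; rewrite mul1r.
Qed.

Lemma beta_symbol (x : R) :
  laurent_symbol (beta R p p') p' p'.+1 (expi x) = 'i%C * toC (central_eta p p' x).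
Proof.
set b := fun k : int => - 2 * (c k * d k / k%:~R).
transitivity (\sum_(k <- zrange p' p'.+1) toC (b k) * expi x ^ k).
  rewrite /laurent_symbol !big_seq; apply: eq_bigr => k.
  by rewrite mem_zrange => kp'; rewrite (betaE _ pp')//; lia.
(* The range may grow from p' to p because d_k = 0 for |k| > p'. *)
rewrite -(@sum_zrange_widen _ _ p' p)//; last first.
  by move=> k kp'; rewrite /b [d k]weight_out// mulr0 mul0r mulr0 rmorph0 mul0r.
rewrite sum_odd_expi; last 2 first.
- exact: zrange_sym.
- by move=> k; rewrite /b !weightN mulrNz invrN !mulrN.
congr (_ * toC _); rewrite /central_eta /symbol_eta /prod_prim mulr_sumr.
by apply: eq_bigr => k _; rewrite /b; ring.
Qed.

Lemma bcoef_symbol (x : R) :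
  laurent_symbol (bcoef R p p') p' p'.+1 (expi x) = toC (central_B p p' x).
Proof.
set b := fun k : int => - 6 * (c k * d k / k%:~R ^+ 2).
transitivity (toC (- 6 * \sum_(k <- zrange p p.+1) tcoef (zrange p p.+1) c d k)
  + \sum_(k <- zrange p' p'.+1) toC (b k) * expi x ^ k).
  rewrite /laurent_symbol [LHS]sum_zrange_sym [X in _ = _ + X]sum_zrange_sym bcoef0// expr0z.
  rewrite {1}/b expr0n invr0 !mulr0 rmorph0 mul0r add0r mulr1; congr (_ + _).
    rewrite !big_nat; apply: eq_bigr => k /andP[k0 kp'].
  by rewrite !(bcoef_neq0 _ pp')//; lia.
rewrite -(@sum_zrange_widen _ _ p' p)//; last first.
  by move=> k kp'; rewrite /b [d k]weight_out// mulr0 mul0r mulr0 rmorph0 mul0r.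
rewrite sum_even_expi; last 2 first.
- exact: zrange_sym.
- by move=> k; rewrite /b !weightN mulrNz sqrrN.
rewrite -rmorphD; congr toC; rewrite /central_B /symbol_B; congr (_ + _).
by rewrite -mulNr mulr_sumr; apply: eq_bigr => k _; rewrite /b; ring.
Qed.

End Symbols.

(** * Determinants and characteristic polynomials with diagonal blocks *)

Section DiagonalBlocks.
Set Implicit Arguments.
Unset Strict Implicit.

(** Diagonal blocks commute, so right multiplication by the block matrix with rows (D, 0) and (-C,
    1) gives a block upper triangular matrix, and det D is cancelled. For characteristic polynomials
    D has monic linear entries, which are nonzero. *)
Lemma det_diag_blocks (A : idomainType) (m : nat) (a b c d : 'rV[A]_m) :
    (forall i, d 0 i != 0) ->
  \det (block_mx (diag_mx a) (diag_mx b) (diag_mx c) (diag_mx d))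
    = \prod_i (a 0 i * d 0 i - b 0 i * c 0 i).
Proof.
move=> d0; set Da := diag_mx a; set Db := diag_mx b.
set Dc := diag_mx c; set Dd := diag_mx d.
have detd : \det Dd != 0 by rewrite det_diag; apply/prodf_neq0 => i _.
apply: (mulIf detd).
transitivity (\det (block_mx Da Db Dc Dd *m block_mx Dd 0 (- Dc) 1%:M)).
  by rewrite det_mulmx det_lblock det1 mulr1.
rewrite mulmx_block !mulmx0 !mulmx1 !mulmxN !add0r.
rewrite [Dc *m _]diag_mxC subrr det_ublock; congr (_ * _).
have -> : Da *m Dd - Db *m Dc = diag_mx (\row_i (a 0 i * d 0 i - b 0 i * c 0 i)).
  by rewrite !mulmx_diag -raddfB; congr diag_mx; apply/rowP => i; rewrite !mxE.
by rewrite det_diag; apply: eq_bigr => i _; rewrite mxE.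
Qed.

Variable F : fieldType.

Lemma char_poly_similar (m : nat) (V A B : 'M[F]_m) :
  V \in unitmx -> A *m V = V *m B -> char_poly A = char_poly B.
Proof.
move=> Vu AV; have detV : (\det V)%:P != 0 by rewrite polyC_eq0 -unitfE -unitmxE.
apply: (mulIf detV); rewrite [RHS]mulrC -!det_map_mx -!det_mulmx; congr (\det _).
rewrite /char_poly_mx mulmxBl mulmxBr scalar_mxC; congr (_ - _).
by rewrite -!map_mxM AV.
Qed.

Lemma char_poly_diag_blocks (m : nat) (a b c d : 'rV[F]_m) :
  char_poly (block_mx (diag_mx a) (diag_mx b) (diag_mx c) (diag_mx d))
    = \prod_i (('X - (a 0 i)%:P) * ('X - (d 0 i)%:P) - (b 0 i * c 0 i)%:P).
Proof.
rewrite /char_poly /char_poly_mx scalar_mx_block map_block_mx.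
rewrite opp_block_mx add_block_mx !add0r.
have diagE (e : 'rV[F]_m) : 'X%:M - map_mx polyC (diag_mx e)
    = diag_mx (\row_i ('X - (e 0 i)%:P)).
  apply/matrixP => i j; rewrite !mxE; case: eqP => [->|_]; first by rewrite !mulr1n.
  by rewrite !mulr0n subrr.
have diagN (e : 'rV[F]_m) : - map_mx polyC (diag_mx e)
    = diag_mx (\row_i - (e 0 i)%:P).
  apply/matrixP => i j; rewrite !mxE; case: eqP => [->|_]; first by rewrite !mulr1n.
  by rewrite !mulr0n oppr0.
rewrite !diagE !diagN det_diag_blocks => [|i]; last by rewrite !mxE polyXsubC_eq0.
by apply: eq_bigr => i _; rewrite !mxE mulrNN polyCM.
Qed.

End DiagonalBlocks.

(** * The cyclic shift and the discrete Fourier matrix *)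

Section Circulant.
Set Implicit Arguments.
Unset Strict Implicit.
Variables (R : realType) (n : nat).
Local Notation N := n.+1.
Local Notation toC := (real_complex R).
Local Notation shift := (shift_mx R n).

Lemma mul_shift_mx (A : nzRingType) (m : nat) (u : 'M[A]_(N, m)) (i : 'I_N) (j : 'I_m) :
  ((\matrix_(i, j) (j == ordS i)%:R : 'M[A]_N) *m u) i j = u (ordS i) j.
Proof.
rewrite mxE (bigD1 (ordS i))//= mxE eqxx mul1r big1 ?addr0// => k /negPf kS.
by rewrite mxE kS mul0r.
Qed.

Lemma shift_unit : shift \in unitmx.
Proof.
have : shift *m shift^T = 1%:M.
  apply/matrixP => i j; rewrite mul_shift_mx !mxE.
  by rewrite (inj_eq (@ordS_inj N)) eq_sym.
by case/mulmx1_unit.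
Qed.

Definition root_angle (m : 'I_N) : R := 2 * pi * m%:R / N%:R.

Definition unity_root (m : 'I_N) : R[i] := expi (root_angle m).

Lemma expi_2pi_nat (k : nat) : expi (k%:R * (2 * pi)) = 1 :> R[i].
Proof.
rewrite pmulrn -expi_exprz /expi mulr_natl cos2pi sin2pi.
exact: exp1rz.
Qed.

Lemma unity_root_exp (m : 'I_N) : unity_root m ^+ N = 1.
Proof.
rewrite -[_ ^+ _]/(_ ^ N%:Z) expi_exprz -pmulrn /root_angle mulrC divfK ?pnatr_eq0//.
by rewrite mulrC expi_2pi_nat.
Qed.

Lemma expi_neq1 (y : R) : 0 < y -> y < 2 * pi -> expi y != 1.
Proof.
move=> y0 y2; rewrite eq_complex /= negb_and; apply/orP; left.
have cos_neq1 x : 0 < x -> x <= pi -> cos x != 1 :> R.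
  move=> x0 xpi; rewrite -cos0 (inj_in_eq (@cos_inj R)) ?gt_eqF// in_itv /=.
    by rewrite ltW.
  by rewrite lexx pi_ge0.
have [ypi|ypi] := leP y pi; first exact: cos_neq1.
rewrite -cosN -(cosD2pi (- y)) -mulr_natl cos_neq1//; lra.
Qed.

Lemma unity_root_inj : injective unity_root.
Proof.
have lt_neq (i j : 'I_N) : (i < j)%N -> unity_root i != unity_root j.
  move=> ij; apply/eqP => e.
  have jiE : root_angle j = (root_angle j - root_angle i) + root_angle i by rewrite subrK.
  have : expi (root_angle j - root_angle i) != 1.
    have -> : root_angle j - root_angle i = 2 * pi * (j - i)%N%:R / N%:R.
      by rewrite /root_angle natrB ?(ltnW ij)// -mulrBl -mulrBr.
    have N0 : 0 < (N%:R : R) by rewrite ltr0n.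
    have pi0 : 0 < 2 * pi :> R by rewrite mulr_gt0// pi_gt0.
    apply: expi_neq1; first by rewrite divr_gt0// mulr_gt0// ltr0n subn_gt0.
    rewrite ltr_pdivrMr// ltr_pM2l// ltr_nat.
    by rewrite (leq_ltn_trans (leq_subr _ _)).
  move: e; rewrite /unity_root {1}jiE expiD => /eqP.
  rewrite eq_sym -subr_eq0 -{2}[expi (root_angle i)]mul1r -mulrBl mulf_eq0.
  by rewrite subr_eq0 (negPf (expi_neq0 _)) orbF => ->.
move=> i j e; have [ij|ji|/val_inj//] := ltngtP i j.
  by move: (lt_neq _ _ ij); rewrite e eqxx.
by move: (lt_neq _ _ ji); rewrite e eqxx.
Qed.

(** Column m lists the powers of the m-th root of unity and is an eigenvector of the shift. *)
Definition fourier_mx : 'M[R[i]]_N := Vandermonde N (\row_m unity_root m).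

Lemma fourier_unit : fourier_mx \in unitmx.
Proof.
rewrite unitmxE det_Vandermonde unitfE; apply/prodf_neq0 => i _.
apply/prodf_neq0 => j ij; rewrite !mxE subr_eq0 (inj_eq unity_root_inj).
by apply: contraTneq ij => ->; rewrite ltnn.
Qed.

Lemma shift_fourier (k : int) :
  map_mx toC (shift ^ k) *m fourier_mx
    = fourier_mx *m diag_mx (\row_m unity_root m ^ k).
Proof.
pose Z k := diag_mx (\row_m unity_root m ^ k) : 'M[R[i]]_N.
have ZS (j : int) : Z 1 *m Z j = Z (1 + j).
  rewrite mulmx_diag; congr diag_mx; apply/rowP => m; rewrite !mxE.
  by rewrite expfzDr// expi_neq0.
have S1 : map_mx toC shift *m fourier_mx = fourier_mx *m Z 1.
  have -> : map_mx toC shift = \matrix_(i, j) (j == ordS i)%:R.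
    by apply/matrixP => i j; rewrite !mxE rmorph_nat.
  apply/matrixP => i m; rewrite mul_shift_mx mul_mx_diag !mxE.
  rewrite -exprSr /=; have := ltn_ord i; rewrite ltnS leq_eqVlt.
  (* In the last row the shift wraps around, which is consistent because the N-th power of the root
     is 1. *)
  move=> /predU1P[->|iN]; first by rewrite modnn expr0 unity_root_exp.
  by rewrite modn_small.
have SS (j : int) : map_mx toC (shift ^ (1 + j)) = map_mx toC shift *m map_mx toC (shift ^ j).
  by rewrite exprzDr ?shift_unit// expr1z map_mxM.
have toC_shift : map_mx toC shift \in unitmx by rewrite map_unitmx shift_unit.
(* The shift is invertible, so the step works in both directions and reaches the negative powers. *)
rewrite -/(Z k); have step j : (map_mx toC (shift ^ j) *m fourier_mx = fourier_mx *m Z j)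
    <-> (map_mx toC (shift ^ (1 + j)) *m fourier_mx = fourier_mx *m Z (1 + j)).
  rewrite SS -ZS -mulmxA [fourier_mx *m (_ *m _)]mulmxA -S1 -mulmxA; split=> [->//|].
  by move/(congr1 (mulmx (invmx (map_mx toC shift)))); rewrite !mulKmx.
elim/int_rect: k => [|k IHk|k IHk].
- rewrite expr0z map_mx1 mul1mx (_ : Z 0 = 1%:M) ?mulmx1//.
  by apply/matrixP => i j; rewrite !mxE expr0z.
- by rewrite intS; apply: (step _).1.
- by apply: (step _).2; rewrite (_ : 1 + - k.+1%:Z = - k%:Z)//; lia.
Qed.

End Circulant.

(** * The semi-discrete equations in matrix form *)

Section MatrixForm.
Set Implicit Arguments.
Unset Strict Implicit.
Variables (R : realType) (n : nat).
Local Notation N := n.+1.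

Lemma at_index_ordS (v : 'cV[R]_N) (j : 'I_N) (k : int) :
  at_index v ((ordS j : nat)%:Z + k) = at_index v (j%:Z + (1 + k)).
Proof.
rewrite /at_index /= -modz_nat modzDml; congr (v (inord (absz (_ %% _)%Z)) 0); lia.
Qed.

Lemma mul_shift_cV (v : 'cV[R]_N) (j : 'I_N) : (shift_mx R n *m v) j 0 = v (ordS j) 0.
Proof. exact: mul_shift_mx. Qed.

Lemma exp_shift_mulE (v : 'cV[R]_N) (k : int) (j : 'I_N) :
  (shift_mx R n ^ k *m v) j 0 = at_index v (j%:Z + k).
Proof.
pose u k : 'cV[R]_N := \col_j at_index v (j%:Z + k).
suff : shift_mx R n ^ k *m v = u k by move=> ->; rewrite mxE.
have uS i : shift_mx R n *m u i = u (1 + i).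
  by apply/colP => l; rewrite mul_shift_cV !mxE at_index_ordS.
have SS (i : int) : shift_mx R n ^ (1 + i) *m v = shift_mx R n *m (shift_mx R n ^ i *m v).
  by rewrite exprzDr ?shift_unit// expr1z mulmxA.
elim/int_rect: k => [|k IHk|k IHk].
- rewrite expr0z mul1mx; apply/colP => l; rewrite mxE /at_index addr0 modz_nat.
  by rewrite modn_small// inord_val.
- by rewrite intS SS IHk uS.
(* Downwards, both sides are compared after one application of the injective shift. *)
- apply: (can_inj (mulKmx (shift_unit R n))); rewrite -SS uS.
  by rewrite (_ : 1 + - k.+1%:Z = - k%:Z)//; lia.
Qed.

Lemma laurent_shift_mulE (a : int -> R) (m m' : nat) (v : 'cV[R]_N) (j : 'I_N) :
  (laurent_shift n a m m' *m v) j 0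
    = \sum_(k <- zrange m m') a k * at_index v (j%:Z + k).
Proof.
rewrite /laurent_shift mulmx_suml summxE; apply: eq_bigr => k _.
by rewrite -scalemxAl mxE exp_shift_mulE.
Qed.

Lemma shift_sub_laurent_mulE (a : int -> R) (m m' : nat) (v : 'cV[R]_N) (j : 'I_N) :
  ((shift_mx R n - 1) * laurent_shift n a m m' *m v) j 0
    = \sum_(k <- zrange m m') a k * at_index v (j%:Z + 1 + k)
      - \sum_(k <- zrange m m') a k * at_index v (j%:Z + k).
Proof.
rewrite -mulmxE -mulmxA mulmxBl mul1mx [LHS]mxE [X in _ + X = _]mxE mul_shift_cV !laurent_shift_mulE.
by congr (_ - _); apply: eq_bigr => k _; rewrite at_index_ordS addrA.
Qed.

Lemma hv_methodE (p p' q q' : nat) (nu h : R) (dwb dw wb w : 'cV[R]_N) : h != 0 ->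
  hv_method p p' q q' nu h dwb dw wb w <->
  col_mx dwb dw = (nu / h ^+ 2) *: (hv_matrix R n p p' q q' *m col_mx wb w).
Proof.
move=> h0; rewrite /hv_matrix mul_block_col scale_col_mx /hv_method.
set X := _ *: _; set Y := (nu / h ^+ 2) *: (laurent_shift _ _ _ _ *m _ + _).
have XE (j : 'I_N) : X j 0 = nu / h * (Dx p p' h wb w (j%:Z + 1) - Dx p p' h wb w j%:Z).
  rewrite /X mxE [Z in _ * Z = _]mxE !shift_sub_laurent_mulE /Dx; field; exact: h0.
have YE (j : 'I_N) : Y j 0 = nu * Dxx q q' h wb w j%:Z.
  rewrite /Y mxE [Z in _ * Z = _]mxE !laurent_shift_mulE /Dxx; field; exact: h0.
split=> [H|/eq_col_mx[-> ->] j]; last by rewrite XE YE !subrr.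
congr col_mx; apply/colP => j; have [/eqP + /eqP +] := H j; rewrite !subr_eq0.
  by rewrite XE => /eqP.
by rewrite YE => _ /eqP.
Qed.

End MatrixForm.

(** * Spectrum and stability of K *)

Section Stability.
Set Implicit Arguments.
Unset Strict Implicit.
Variables (R : realType) (n p p' q q' : nat).
Hypothesis p0 : (0 < p)%N.
Hypothesis pp' : (p.-1 <= p' <= p)%N.
Hypothesis q0 : (0 < q)%N.
Hypothesis qq' : (q.-1 <= q' <= q)%N.
Local Notation N := n.+1.
Local Notation toC := (real_complex R).
Local Notation V := (fourier_mx R n).
Local Notation s := (@unity_root R n).

Lemma laurent_fourier (a : int -> R) (m m' : nat) :
  map_mx toC (laurent_shift n a m m') *m V
    = V *m diag_mx (\row_i laurent_symbol a m m' (s i)).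
Proof.
rewrite /laurent_shift raddf_sum mulmx_suml /=.
under eq_bigr do rewrite map_mxZ -scalemxAl shift_fourier scalemxAr.
rewrite -mulmx_sumr; congr (_ *m _).
apply/matrixP => i j; rewrite summxE !mxE.
have [->|ij] := eqVneq i j; last by rewrite big1// => k _; rewrite !mxE (negPf ij) mulr0.
by rewrite mulr1n; apply: eq_bigr => k _; rewrite !mxE eqxx mulr1n.
Qed.

Lemma shift_sub_laurent_fourier (a : int -> R) (m m' : nat) :
  map_mx toC ((shift_mx R n - 1) * laurent_shift n a m m') *m V
    = V *m diag_mx (\row_i ((s i - 1) * laurent_symbol a m m' (s i))).
Proof.
rewrite -mulmxE map_mxM -mulmxA laurent_fourier mulmxA.
have -> : map_mx toC (shift_mx R n - 1) *m V = V *m diag_mx (\row_i (s i - 1)).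
  rewrite map_mxB map_mx1 mulmxBl mul1mx -[shift_mx R n]expr1z shift_fourier.
  apply/matrixP => i j; rewrite mxE !mul_mx_diag !mxE; ring.
rewrite -mulmxA mulmx_diag; congr (_ *m diag_mx _).
by apply/rowP => i; rewrite !mxE.
Qed.

Lemma unity_root_angle (i : 'I_N) : exists2 x : R, s i = expi x & `|x| <= pi.
Proof. by apply: norm1_expi => /=; exact: cos2Dsin2. Qed.

Definition symbol_poly (x : R) : {poly R[i]} :=
  'X ^+ 2 - (toC (central_tr p p' q q' x))%:P * 'X
  + (toC (central_det p p' q q' x))%:P.

Lemma char_poly_hv_matrix (x : 'I_N -> R) : (forall i, s i = expi (x i)) ->
  char_poly (map_mx toC (hv_matrix R n p p' q q')) = \prod_i symbol_poly (x i).
Proof.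
move=> xE.
have Wu : block_mx V 0 0 V \in unitmx.
  by rewrite unitmxE det_ublock unitrM -!unitmxE fourier_unit.
have KW : map_mx toC (hv_matrix R n p p' q q') *m block_mx V 0 0 V
  = block_mx V 0 0 V *m block_mx
     (diag_mx (\row_i ((s i - 1) * laurent_symbol (alpha R p p') p p (s i))))
     (diag_mx (\row_i ((s i - 1) * laurent_symbol (beta R p p') p' p'.+1 (s i))))
     (diag_mx (\row_i laurent_symbol (acoef R q q') q q (s i)))
     (diag_mx (\row_i laurent_symbol (bcoef R q q') q' q'.+1 (s i))).
  rewrite map_block_mx !mulmx_block !mulmx0 !mul0mx !addr0 !add0r.
  by rewrite !shift_sub_laurent_fourier !laurent_fourier.
rewrite (char_poly_similar Wu KW) char_poly_diag_blocks; apply: eq_bigr => i _.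
rewrite !mxE xE alpha_symbol// bcoef_symbol//.
(* The factor s - 1 of the upper right entry is moved to the lower left one, so that the product of
   the two entries is (i eta) (i gamma). *)
have -> : (expi (x i) - 1) * laurent_symbol (beta R p p') p' p'.+1 (expi (x i))
    * laurent_symbol (acoef R q q') q q (expi (x i))
  = - toC (central_eta p p' (x i) * central_gamma q q' (x i)).
  rewrite mulrAC acoef_symbol// beta_symbol// mulrACA -expr2 sqr_i.
  by rewrite mulN1r -rmorphM mulrC.
have trE : toC (central_tr p p' q q' (x i))
    = toC (central_g p p' (x i)) + toC (central_B q q' (x i)).
  exact: (rmorphD toC).
have detE : toC (central_det p p' q q' (x i))
    = toC (central_g p p' (x i)) * toC (central_B q q' (x i))
    + toC (central_eta p p' (x i) * central_gamma q q' (x i)).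
  by rewrite -(rmorphM toC) -(rmorphD toC).
rewrite /symbol_poly trE detE !polyCD polyCM polyCN; ring.
Qed.

(** For z = a + i b the imaginary part of the equation is (2 a - t) b = 0. Either a = t / 2 < 0, or
    z is real, and then a >= 0 would make a^2 - t a + d positive. *)
Lemma root_quadratic_neg (t d : R) (z : R[i]) : t < 0 -> 0 < d ->
  root ('X ^+ 2 - (toC t)%:P * 'X + (toC d)%:P) z -> complex.Re z < 0.
Proof.
move=> t0 d0; rewrite /root !hornerE; case: z => a b /=.
rewrite expr2 eq_complex /= => /andP[/eqP re0 /eqP im0].
have : (2 * a - t) * b = 0 by lra.
move/eqP; rewrite mulf_eq0 => /orP[/eqP|/eqP b0]; first lra.
rewrite ltNge; apply/negP => a0; rewrite b0 in re0.
have : 0 <= a * a by rewrite mulr_ge0.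
have : 0 <= - t * a by rewrite mulr_ge0// oppr_ge0 ltW.
lra.
Qed.

Lemma hv_matrix_stable : stable_mx (map_mx toC (hv_matrix R n p p' q q')).
Proof.
(* The angles are chosen anew in [-pi, pi], where [central_stable] applies; [root_angle] runs
   through [0, 2 pi). *)
have [x xE xpi] : exists2 x : 'I_N -> R, forall i, s i = expi (x i)
    & forall i, `|x i| <= pi.
  have [x xP] := choice (fun i : 'I_N => let: ex_intro2 y e l := unity_root_angle i in
     ex_intro (fun y => s i = expi y /\ `|y| <= pi) y (conj e l)).
  by exists x => i; case: (xP i).
have s0 : s 0 = 1 by rewrite /unity_root /root_angle mulr0 mul0r expi0.
have x_neq0 i : i != 0 -> x i != 0.
  apply: contraNneq => xi; apply/eqP/(@unity_root_inj R n).
  by rewrite s0 xE xi expi0.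
(* The only angle in [-pi, pi] with exp (i x) = 1 is 0. *)
have x00 : x 0 = 0.
  have [//|x0] := eqVneq (x 0) 0.
  have /eqP := xE 0; rewrite s0 eq_sym => e.
  have pi0 := pi_gt0 R.
  have [gt0|le0] := ltP 0 (x 0).
    have x2 : x 0 < 2 * pi by have := xpi 0; rewrite gtr0_norm//; lra.
    by have := expi_neq1 gt0 x2; rewrite e.
  have lt0 : 0 < - x 0 by rewrite oppr_gt0 lt_neqAle x0.
  have x2 : - x 0 < 2 * pi by have := xpi 0; rewrite -normrN gtr0_norm//; lra.
  by have := expi_neq1 lt0 x2; rewrite -expiV (eqP e) invr1 eqxx.
set B := toC (central_B q q' 0).
have B0 : central_B q q' (0 : R) < 0 := central_B_lt0 q0 qq' 0.
(* The constant mode: g and eta vanish at 0, which leaves the roots 0 and B(0) < 0. *)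
have sym0 : symbol_poly (x 0) = 'X * ('X - B%:P).
  rewrite x00 /symbol_poly /central_tr /central_det central_g0 central_eta0.
  by rewrite !mul0r !addr0 add0r mulrBr -expr2 ['X * _%:P]mulrC.
(* The other modes have all their roots in the open left half plane, so an eigenvalue with
   nonnegative real part comes from the constant mode. *)
have rest_root z : ~~ (complex.Re z < 0) ->
    ~~ root (\prod_(i < N | i != 0) symbol_poly (x i)) z.
  move=> z0; rewrite rootE horner_prod; apply/prodf_neq0 => i i0.
  rewrite -[_ == 0]/(root _ _); apply: contra z0.
  by have [] := central_stable p0 pp' q0 qq' (x_neq0 i i0) (xpi i); exact: root_quadratic_neg.
move=> z; rewrite eigenvalue_root_char (char_poly_hv_matrix xE) (bigD1 0)//= sym0.
have [|z0] := boolP (complex.Re z < 0); first by left.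
rewrite !rootM (negPf (rest_root z z0)) orbF rootX root_XsubC => /orP[/eqP zE|/eqP zE].
  (* The root 0 is simple: neither X - B(0) nor the product over the other modes vanishes there. *)
  right; rewrite zE; split=> //; rewrite mupMl ?mupMl.
  - by rewrite -['X]subr0 -polyC0 -['X - _]expr1 mup_XsubCX eqxx.
  - rewrite root_XsubC; apply/eqP => /(congr1 (@complex.Re R)) /= BE.
    by rewrite -BE ltxx in B0.
  - by apply: rest_root; rewrite -zE.
by rewrite zE /= B0 in z0.
Qed.

End Stability.

Theorem theorem4p6 (R : realType) (p p' q q' : nat)
    (hp : (p.-1 <= p' <= p)%N) (hpp : (1 <= p + p')%N)
    (hq : (q.-1 <= q' <= q)%N) (hqq : (1 <= q + q')%N)
    (nu L : R) (hnu : 0 < nu) (hL : 0 < L) (n : nat) :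
  let h := L / n.+1%:R in
  let K := hv_matrix R n p p' q q' in
  (forall dwb dw wb w : 'cV[R]_n.+1,
     hv_method p p' q q' nu h dwb dw wb w <->
     col_mx dwb dw = (nu / h ^+ 2) *: (K *m col_mx wb w))
  /\ stable_mx (map_mx (real_complex R) K).
Proof.
move=> h K; split.
  by move=> dwb dw wb w; apply: hv_methodE; rewrite mulf_neq0 ?gt_eqF ?invr_gt0 ?ltr0n.
(* If p = 0 then p' = 0, against p + p' >= 1; hence p > 0, and likewise q > 0. *)
by apply: hv_matrix_stable => //; lia.
Qed.
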